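(* Let $\varphi$ be a positive linear map on a unital $C^*$-algebra $\mathcal{A}$ with $r=r(\varphi)$. The following are equivalent: (1) there is a positive map $\psi$ on $\mathcal{A}$ elementarily similar to $\varphi$ with $\|\psi\|=r$; (2) there exists a strictly positive $w\in\mathcal{A}$ with $\varphi(w)\le r\,w$; (3) there exists a strictly positive $v\in\mathcal{A}$ with $\|\alpha_v^{-1}\circ\varphi\circ\alpha_v\|=r$.
   Context: $r(\varphi)$ is the spectral radius of $\varphi$ as a bounded operator on $\mathcal{A}$; $\|\cdot\|$ is the operator norm. Strictly positive means positive and invertible. For $a\in\mathcal{A}$, $\alpha_a(x)=a^*xa$; for invertible $a$, $\alpha_a^{-1}(x)=(a^* )^{-1}xa^{-1}$. A positive map $\psi$ is elementarily similar to $\varphi$ if $\varphi=\alpha_a^{-1}\circ\psi\circ\alpha_a$ for some invertible $a\in\mathcal{A}$. *)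

(* Defs.v *)
(* mathcomp + real_closed complex + mathcomp-analysis *)
From mathcomp Require Import all_boot all_algebra.
From mathcomp Require Import complex.
From mathcomp Require Import all_classical all_reals all_analysis.
Import GRing.Theory Num.Theory.
Set Implicit Arguments.
Unset Strict Implicit.
Local Open Scope ring_scope.
Local Open Scope complex_scope.
Local Open Scope classical_set_scope.

(* A unital C*-algebra: a complex Banach space A (completeNormedModType over
   C = R[i]) together with a multiplication, a unit and an involution
   satisfying the axioms of a unital Banach *-algebra and the C*-identity. *)
Record unital_cstar_alg (R : realType) (A : completeNormedModType (R[i])) := UCstar {
  cmul : A -> A -> A;
  cone : A;
  cstar : A -> A;
  cmulA : forall x y z, cmul x (cmul y z) = cmul (cmul x y) z;
  cmulDl : forall x y z, cmul (x + y) z = cmul x z + cmul y z;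
  cmulDr : forall x y z, cmul x (y + z) = cmul x y + cmul x z;
  cmulZl : forall (k : R[i]) x y, cmul (k *: x) y = k *: cmul x y;
  cmulZr : forall (k : R[i]) x y, cmul x (k *: y) = k *: cmul x y;
  cmul1l : forall x, cmul cone x = x;
  cmul1r : forall x, cmul x cone = x;
  cnorm_mul : forall x y, `|cmul x y| <= `|x| * `|y|;
  cstarK : forall x, cstar (cstar x) = x;
  cstarD : forall x y, cstar (x + y) = cstar x + cstar y;
  cstarZ : forall (k : R[i]) x, cstar (k *: x) = (k^*)%C *: cstar x;
  cstarM : forall x y, cstar (cmul x y) = cmul (cstar y) (cstar x);
  cstar_identity : forall x, `|cmul (cstar x) x| = `|x| ^+ 2
}.

Section Defs.
Context {R : realType} {A : completeNormedModType (R[i])} (C : unital_cstar_alg A).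

Local Notation "x *a y" := (cmul C x y) (at level 40, left associativity).
Local Notation star := (cstar C).
Local Notation one := (cone C).

(* real-valued norm on A *)
Definition rnorm (x : A) : R := complex.Re `|x|.

(* b is a (two-sided) inverse of a *)
Definition is_inverse (a b : A) : Prop := a *a b = one /\ b *a a = one.
Definition invertible (a : A) : Prop := exists b, is_inverse a b.

Definition spectrum (a : A) : set (R[i]) := [set l | ~ invertible (a - l *: one)].

Definition selfadjoint (a : A) : Prop := star a = a.

(* positive: self-adjoint with spectrum in [0, +oo) *)
Definition positive (a : A) : Prop :=
  selfadjoint a /\ forall l, spectrum a l -> 0 <= l.

Definition strictly_positive (a : A) : Prop := positive a /\ invertible a.

(* the order on self-adjoint elements: x <= y iff y - x is positive *)
Definition cle (x y : A) : Prop := positive (y - x).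

(* linear maps A -> A *)
Definition linear_map (f : A -> A) : Prop :=
  forall (k : R[i]) x y, f (k *: x + y) = k *: f x + f y.

Definition bounded_map (f : A -> A) : Prop :=
  exists M : R, forall x, rnorm (f x) <= M * rnorm x.

Definition positive_map (f : A -> A) : Prop :=
  linear_map f /\ forall a, positive a -> positive (f a).

(* operator norm *)
Definition opnorm (f : A -> A) : R :=
  sup [set rnorm (f x) | x in [set x | rnorm x <= 1]].

(* spectrum of f as an element of the Banach algebra B(A) of bounded operators *)
Definition op_spectrum (f : A -> A) : set (R[i]) :=
  [set l | ~ exists g : A -> A, linear_map g /\ bounded_map g /\
        (forall x, g (f x - l *: x) = x) /\ (forall x, f (g x) - l *: g x = x)].

(* spectral radius of f *)
Definition op_spectral_radius (f : A -> A) : R :=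
  sup [set complex.Re `|l| | l in op_spectrum f].

(* alpha_a (x) = a^* x a *)
Definition alpha (a : A) (x : A) : A := star a *a x *a a.

(* alpha_a^{-1} (x) = (star a)^{-1} x a^{-1}, given c = inverse of star a, b = inverse of a *)
Definition alpha_inv (c b : A) (x : A) : A := c *a x *a b.

End Defs.

(* Main.v *)
(* Conjugating by [v = w^(1/2)] turns [phi w <= r w] into [psi 1 <= r] for the positive map
   [psi = alpha_v^-1 o phi o alpha_v], and a positive map satisfies [|psi| = |psi 1|]; on the other
   hand [r = r(phi) = r(psi) <= |psi|].  Conversely [|psi| = r] gives [psi 1 <= r], which reads
   [phi w <= r w] for [w = b^* b], [b = a^-1].

   The identity [|psi| = |psi 1|] (Russo-Dye) is obtained without functional calculus: for
   [|x| < 1] the operator Poisson kernel [P(w) = (1 - w x)^-1 + ((1 - w x)^-1)^* - 1] equals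
   [(1 - w x)^-*  (1 - x^* x) (1 - w x)^-1 >= 0], and averaging [P] and [conj w P] over roots of
   unity approximates [1] and [x].  A Cauchy-Schwarz argument then bounds
   [sum_i mu_i psi(p_i)] by [sum_i psi(p_i)] for unimodular [mu_i] and positive [p_i]. *)
Require Import Defs.
From HB Require Import structures.
From mathcomp Require Import all_boot all_order all_algebra cyclic separable cyclotomic.
From mathcomp Require Import complex.
From mathcomp Require Import all_classical all_reals all_analysis.
From mathcomp Require Import ring lra.
From Stdlib Require Ncring Ncring_tac.
Import Order.TTheory GRing.Theory Num.Theory numFieldNormedType.Exports.
Set Implicit Arguments.
Unset Strict Implicit.
Unset Printing Implicit Defensive.
Local Open Scope ring_scope.
Local Open Scope complex_scope.
Local Open Scope classical_set_scope.

(** The obstacle is positivity itself: its spectral definition does not show that sums of positive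
    elements, or elements [b^* b], are positive. The cone is therefore rebuilt on the condition |t -
    x| <= t. The analytic tool is the contraction principle, which yields inverses and square roots,
    but roots of strictly positive elements only. This shapes the rest: a positive element is first
    shifted by a small d > 0, conjugation is by invertible elements, and the shift is removed at the
    end because the cone is closed ([npos_closed]). For self-adjoint x the sharp bound on psi x
    follows from -|x| <= x <= |x|; splitting a general x into real and imaginary parts loses a
    factor 2, which is why x is approximated by unimodular combinations of positive elements
    instead. *)

Section Norm.
Context {R : realType}.
Implicit Types (k l : R[i]) (t : R).

(** * Real-valued absolute value and norm *)

Definition cabs k : R := complex.Re `|k|.

Lemma cabsE k : `|k| = (cabs k)%:C.
Proof.
rewrite /cabs; have := normr_ge0 k; case: `|k| => a b.
by rewrite lecE /= => /andP[/eqP -> _].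
Qed.
Lemma cabs_ge0 k : 0 <= cabs k.
Proof. by have := normr_ge0 k; rewrite cabsE lecR. Qed.
Lemma cabsR t : cabs t%:C = `|t|.
Proof. by rewrite /cabs normc_def /= expr0n addr0 sqrtr_sqr. Qed.
Lemma cabsV k : cabs k^-1 = (cabs k)^-1.
Proof. by apply: complexI; rewrite fmorphV /= -!cabsE normfV. Qed.

Context {A : completeNormedModType (R[i])}.
Implicit Types x y : A.

Lemma rnormE x : `|x| = (rnorm x)%:C.
Proof.
rewrite /rnorm; have := normr_ge0 x; case: `|x| => a b.
by rewrite lecE /= => /andP[/eqP -> _].
Qed.
Lemma rnorm_ge0 x : 0 <= rnorm x.
Proof. by have := normr_ge0 x; rewrite rnormE lecR. Qed.
Lemma ler_rnormD x y : rnorm (x + y) <= rnorm x + rnorm y.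
Proof. by have := ler_normD x y; rewrite !rnormE -rmorphD lecR. Qed.
Lemma rnormN x : rnorm (- x) = rnorm x.
Proof. by rewrite /rnorm normrN. Qed.
Lemma rnormB x y : rnorm (x - y) = rnorm (y - x).
Proof. by rewrite -opprB rnormN. Qed.
Lemma ler_rnormB x y : rnorm (x - y) <= rnorm x + rnorm y.
Proof. by rewrite -(rnormN y) ler_rnormD. Qed.
Lemma rnorm0 : rnorm (0 : A) = 0.
Proof. by rewrite /rnorm normr0. Qed.
Lemma rnorm_eq0 x : rnorm x = 0 -> x = 0.
Proof. by move=> h; apply: normr0_eq0; rewrite rnormE h. Qed.
Lemma rnormZ k x : rnorm (k *: x) = cabs k * rnorm x.
Proof. by apply: complexI; rewrite rmorphM /= -cabsE -!rnormE normrZ. Qed.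
Lemma rnormZr t x : rnorm (t%:C *: x) = `|t| * rnorm x.
Proof. by rewrite rnormZ cabsR. Qed.

End Norm.

(* An alias of [A], so that the multiplication carried by [C] becomes a canonical ring structure. *)
Definition calg (R : realType) (A : completeNormedModType (R[i]))
  (C : unital_cstar_alg A) : Type := A.
HB.instance Definition _ R A C := CompleteNormedModule.copy (@calg R A C) A.
HB.instance Definition _ R A C := GRing.Zmodule_isPzRing.Build (@calg R A C)
  (cmulA C) (cmul1l C) (cmul1r C) (cmulDl C) (cmulDr C).

Definition adj (R : realType) (A : completeNormedModType (R[i])) (C : unital_cstar_alg A)
  (x : calg C) : calg C := cstar C x.

Lemma adj_is_additive (R : realType) (A : completeNormedModType (R[i])) (C : unital_cstar_alg A) :
  zmod_morphism (@adj R A C).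
Proof.
move=> x y; have adjD u v : adj (C:=C) (u + v) = adj u + adj v by exact (cstarD C u v).
apply/(addIr (adj (C:=C) y)); by rewrite -adjD !subrK.
Qed.
HB.instance Definition _ R A C :=
  GRing.isZmodMorphism.Build (calg C) (calg C) (@adj R A C) (@adj_is_additive R A C).

(** Makes noncommutative normalisation available as [ncring]. Commutation is beyond it, so
    identities below often carry commutators such as a x - x a explicitly, to be rewritten to 0
    afterwards. *)
#[local] Instance calg_ring_ops (R : realType) (A : completeNormedModType (R[i]))
  (C : unital_cstar_alg A) :
  @Ncring.Ring_ops (calg C) 0 1 +%R *%R (fun x y => x - y) -%R eq.
Defined.
#[local] Instance calg_ring (R : realType) (A : completeNormedModType (R[i]))
  (C : unital_cstar_alg A) :
  Ncring.Ring (Ro := calg_ring_ops C).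
Proof.
constructor.
- exact: RelationClasses.eq_equivalence.
- by move=> ? ? -> ? ? ->.
- by move=> ? ? -> ? ? ->.
- by move=> ? ? -> ? ? ->.
- by move=> ? ? ->.
- exact (@add0r (calg C)).
- exact (@addrC (calg C)).
- exact (@addrA (calg C)).
- exact (@mul1r (calg C)).
- exact (@mulr1 (calg C)).
- exact (@mulrA (calg C)).
- exact (@mulrDl (calg C)).
- exact (fun x y z => @mulrDr (calg C) z x y).
- done.
- exact (@subrr (calg C)).
Defined.
Ltac ncring := Ncring_tac.non_commutative_ring.

(** * Star algebra, completeness and the contraction principle *)

Section Basics.
Context {R : realType} {A : completeNormedModType (R[i])} (C : unital_cstar_alg A).
Local Notation B := (calg C).
Implicit Types (x y z : B) (k l : R[i]) (s t : R).

Lemma scaleAl k x y : k *: (x * y) = (k *: x) * y.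
Proof. by rewrite -[RHS]/(cmul C (k *: x) y) cmulZl. Qed.
Lemma scaleAr k x y : k *: (x * y) = x * (k *: y).
Proof. by rewrite -[RHS]/(cmul C x (k *: y)) cmulZr. Qed.
Lemma scale1Al k x : (k *: (1 : B)) * x = k *: x.
Proof. by rewrite -scaleAl mul1r. Qed.
Lemma scale1Ar k x : x * (k *: (1 : B)) = k *: x.
Proof. by rewrite -scaleAr mulr1. Qed.

Lemma adjK x : adj (adj x) = x. Proof. exact (cstarK C x). Qed.
Lemma adjM x y : adj (x * y) = adj y * adj x. Proof. exact (cstarM C x y). Qed.
Lemma adjZ k x : adj (k *: x) = conjc k *: adj x. Proof. exact (cstarZ C k x). Qed.
Lemma adjZr t x : adj (t%:C *: x) = t%:C *: adj x.
Proof. by rewrite adjZ /= oppr0. Qed.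
Lemma adj1 : adj (1 : B) = 1.
Proof. by rewrite -[LHS]mulr1 -{2}(adjK 1) -adjM mulr1 adjK. Qed.

Lemma rnormM x y : rnorm (x * y) <= rnorm x * rnorm y.
Proof. rewrite -lecR rmorphM /= -!rnormE; exact (cnorm_mul C x y). Qed.
Lemma rnormX x n : (0 < n)%N -> rnorm (x ^+ n) <= rnorm x ^+ n.
Proof.
case: n => // n _; elim: n => [|n IH]; first by rewrite !expr1.
by rewrite exprS [leRHS]exprS (le_trans (rnormM _ _))// ler_wpM2l ?rnorm_ge0.
Qed.
Lemma rnorm_adjM x : rnorm (adj x * x) = rnorm x ^+ 2.
Proof. apply: complexI; rewrite rmorphXn /= -!rnormE; exact (cstar_identity C x). Qed.
Lemma rnorm_adj x : rnorm (adj x) = rnorm x.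
Proof.
have le y : rnorm y <= rnorm (adj y).
  have [->|y0] := eqVneq (rnorm y) 0; first exact: rnorm_ge0.
  have y_gt0 : 0 < rnorm y by rewrite lt_def y0 rnorm_ge0.
  by rewrite -(ler_pM2r y_gt0) -expr2 -rnorm_adjM rnormM.
by apply/eqP; rewrite eq_le le andbT -[leRHS](congr1 _ (adjK x)) le.
Qed.
Lemma rnorm_sa_sqr x : adj x = x -> rnorm (x * x) = rnorm x ^+ 2.
Proof. by rewrite -rnorm_adjM => ->. Qed.
(** Only an inequality, because the zero algebra, where 1 = 0, is allowed. *)
Lemma rnorm1 : rnorm (1 : B) <= 1.
Proof.
have := rnorm_sa_sqr adj1; rewrite mulr1 => h.
have := rnorm_ge0 (1 : B); nra.
Qed.
Lemma rnorm_scale1 t : rnorm (t%:C *: (1 : B)) <= `|t|.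
Proof. by rewrite rnormZr -[leRHS]mulr1 ler_wpM2l // rnorm1. Qed.

Lemma scale0C x : (0 : R)%:C *: x = 0.
Proof. exact: scale0r. Qed.
Lemma scale1C x : (1 : R)%:C *: x = x.
Proof. exact: scale1r. Qed.
Lemma scaleDC s t x : (s + t)%:C *: x = s%:C *: x + t%:C *: x.
Proof. by rewrite rmorphD scalerDl. Qed.
Lemma scaleBC s t x : (s - t)%:C *: x = s%:C *: x - t%:C *: x.
Proof. by rewrite rmorphB scalerBl. Qed.
Lemma scaleNC t x : (- t)%:C *: x = - (t%:C *: x).
Proof. by rewrite rmorphN scaleNr. Qed.
Lemma scaleMC s t x : (s * t)%:C *: x = s%:C *: (t%:C *: x).
Proof. by rewrite rmorphM scalerA. Qed.

Lemma expr_small (q e : R) : 0 <= q < 1 -> 0 < e -> exists n, q ^+ n < e.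
Proof.
move=> /andP[q0 q1] e0.
have /cvgr0_norm_lt /(_ e e0) : (fun n => q ^+ n) @ \oo --> (0 : R).
  by apply: cvg_expr; rewrite ger0_norm.
by move=> [n _ /(_ n (leqnn n))] /=; rewrite ger0_norm ?exprn_ge0//; exists n.
Qed.

Lemma rnorm_complete (u : nat -> B) :
  (forall e : R, 0 < e -> exists N, forall n m, (N <= n)%N -> (N <= m)%N ->
    rnorm (u n - u m) < e) ->
  exists v : B, forall e : R, 0 < e -> exists N, forall n, (N <= n)%N -> rnorm (v - u n) < e.
Proof.
move=> uC.
(* The order of [R[i]] compares only numbers with equal imaginary parts, so a positive number is
   real. *)
have posE (e : R[i]) : 0 < e -> e = (complex.Re e)%:C /\ 0 < complex.Re e.
  by case: e => a b; rewrite ltcE /= => /andP[/eqP -> ->].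
have : cvgn (u : nat -> A).
  apply/cauchy_cvgP; apply/cauchy_ballP => e /posE[-> e0]; near_simpl.
  have [N hN] := uC _ e0.
  near=> n => /=; rewrite -ball_normE /= rnormE ltcR.
  apply: hN; near: n.
    exists ([set n | N <= n], [set n | True])%N; last by case=> a b [].
    by split; [exists N|exact: filterT].
  exists ([set n | True], [set n | N <= n])%N; last by case=> a b [].
  by split; [exact: filterT|exists N].
move=> /cvgrPdist_lt h; exists (lim (u n @[n --> \oo])) => e e0.
have [|N _ hN] := h e%:C; first by rewrite ltcR.
by exists N => n /hN; rewrite /= rnormE ltcR.
Unshelve. all: end_near. Qed.

(** Contraction principle on the closed set [P]. For inverses and resolvents [P] is trivial; for
    square roots it carries self-adjointness, a norm bound and commutation to the limit. *)
Lemma fixpoint (P : B -> Prop) (f : B -> B) (q : R) (x0 : B) :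
  0 <= q < 1 -> P x0 -> (forall x, P x -> P (f x)) ->
  (forall x y, P x -> P y -> rnorm (f x - f y) <= q * rnorm (x - y)) ->
  (forall z, (forall e : R, 0 < e -> exists2 y, P y & rnorm (z - y) < e) -> P z) ->
  exists2 x, P x & f x = x.
Proof.
move=> /andP[q0 q1] Px0 Pf fq Pcl.
pose u n := iter n f x0.
have Pu n : P (u n) by elim: n => //= n; apply: Pf.
(* [D] is the fixed point of d |-> |f x0 - x0| + q d, so the bound |u m - x0| <= D is stable under
   the induction. *)
pose D := rnorm (f x0 - x0) / (1 - q).
have D0 : 0 <= D by rewrite divr_ge0 ?rnorm_ge0// subr_ge0 ltW.
have DE : rnorm (f x0 - x0) = D - q * D.
  by rewrite /D; field; rewrite subr_eq0 gt_eqF.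
have um m : rnorm (u m - x0) <= D.
  elim: m => [|m IH]; first by rewrite subrr rnorm0.
  rewrite -(subrK (f x0) (u m.+1)) -addrA (le_trans (ler_rnormD _ _))//.
  by have := ler_wpM2l q0 IH; have := fq _ _ (Pu m) Px0; rewrite DE /=; lra.
have unm n m : rnorm (u (n + m)%N - u n) <= q ^+ n * D.
  elim: n => [|n IH]; first by rewrite add0n expr0 mul1r um.
  rewrite addSn /= exprS -mulrA (le_trans (fq _ _ _ _))//.
  exact: ler_wpM2l.
have small e : 0 < e -> exists N, forall n, (N <= n)%N -> q ^+ n * D < e.
  move=> e0; have D1 : 0 < D + 1 by lra.
  have [||N hN] := @expr_small q (e / (D + 1)); [by rewrite q0|by rewrite divr_gt0|].
  exists N => n Nn; have : q ^+ n < e / (D + 1).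
    by apply: le_lt_trans hN; rewrite ler_wiXn2l // ltW.
  rewrite ltr_pdivlMr//; have := exprn_ge0 n q0; nra.
have [e e0|v hv] := @rnorm_complete u.
  have [N hN] := small _ e0; exists N => n m Nn Nm.
  wlog nm : n m Nn Nm / (m <= n)%N.
    move=> W; have [/W|/ltnW/W] := leqP m n; first exact.
    by rewrite rnormB; apply.
  by rewrite -(subnKC nm); apply: le_lt_trans (unm _ _) (hN _ _).
have Pv : P v by apply: Pcl => e /hv[N hN]; exists (u N) => //; exact: hN.
exists v => //; apply/subr0_eq/rnorm_eq0/eqP; rewrite eq_le rnorm_ge0 andbT.
apply/ler_addgt0Pr => e e0; rewrite add0r.
have e20 : 0 < e / 2 by rewrite divr_gt0.
have [N hN] := hv _ e20.
rewrite -(subrK (f (u N)) (f v)) -addrA (le_trans (ler_rnormD _ _))//.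
have := hN N.+1 (leqnSn N); rewrite rnormB /= => h1.
have h2 := hN N (leqnn N); have := fq _ _ Pv (Pu N); have := rnorm_ge0 (v - u N).
by have := rnorm_ge0 (v - f (u N)); rewrite [rnorm (f (u N) - v)]rnormB in h1 *; nra.
Qed.

End Basics.

(** * The positive cone through norms: square roots, order bounds, closedness *)

Section Cone.
Context {R : realType} {A : completeNormedModType (R[i])} (C : unital_cstar_alg A).
Local Notation B := (calg C).
Local Notation "t %:e" := (t%:C *: (1 : B)) (at level 2, format "t %:e").
Implicit Types (x y z c : B) (k : R[i]) (s t d e : R).

Definition sa x := adj x = x.
Definition unitB x := exists2 y, x * y = 1 & y * x = 1.
(* [npos] is a norm criterion for positivity, closed under sums for free; it is equivalent to
   the spectral definition ([positiveE]).  [spos] is its strict version. *)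
Definition npos x := sa x /\ exists t, rnorm (t%:e - x) <= t.
Definition spos x := sa x /\ exists t, rnorm (t%:e - x) < t.

Lemma ler_eps (a b K : R) : (forall e, 0 < e -> a <= b + K * e) -> a <= b.
Proof.
move=> h; apply/ler_addgt0Pr => e e0.
have K1 : 0 < `|K| + 1 by rewrite ltr_wpDl.
apply: (le_trans (h (e / (`|K| + 1)) _)); first by rewrite divr_gt0.
rewrite lerD2l mulrCA ger_pMr // ler_pdivrMr // mul1r.
by have := ler_norm K; lra.
Qed.

Lemma rnorm_eps0 x (K : R) : (forall e, 0 < e -> rnorm x <= K * e) -> x = 0.
Proof.
move=> h; apply: rnorm_eq0; apply/eqP; rewrite eq_le rnorm_ge0 andbT.
by apply: (@ler_eps _ _ K) => e /h; rewrite add0r.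
Qed.

Lemma saD x y : sa x -> sa y -> sa (x + y).
Proof. by rewrite /sa raddfD /= => -> ->. Qed.
Lemma saN x : sa x -> sa (- x).
Proof. by rewrite /sa raddfN /= => ->. Qed.
Lemma saB x y : sa x -> sa y -> sa (x - y).
Proof. by move=> hx hy; apply: saD hx (saN hy). Qed.
Lemma saZ t x : sa x -> sa (t%:C *: x).
Proof. by rewrite /sa adjZr => ->. Qed.
Lemma sa1 : sa 1. Proof. exact: adj1. Qed.
Lemma sa_scale1 t : sa t%:e. Proof. exact: saZ sa1. Qed.
Lemma saM x y : sa x -> sa y -> x * y = y * x -> sa (x * y).
Proof. by rewrite /sa adjM => -> -> ->. Qed.
#[local] Hint Resolve sa1 sa_scale1 : core.

(** A right inverse y = 1 + x y and a left inverse z = 1 + z x are two separate fixed points, which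
    then coincide. *)
Lemma neumann1 x : rnorm x < 1 -> unitB (1 - x).
Proof.
move=> x1; have q01 : 0 <= rnorm x < 1 by rewrite rnorm_ge0.
have [||||y _ yE] := @fixpoint _ _ C (fun=> True) (fun y => 1 + x * y) _ 0 q01 => //.
  move=> y z _ _; rewrite (_ : _ - _ = x * (y - z)) ?rnormM//; ncring.
have [||||z _ zE] := @fixpoint _ _ C (fun=> True) (fun y => 1 + y * x) _ 0 q01 => //.
  move=> y' z _ _; rewrite (_ : _ - _ = (y' - z) * x); last by ncring.
  by rewrite mulrC rnormM.
have y1 : (1 - x) * y = 1 by apply/eqP; rewrite mulrBl mul1r subr_eq /= yE.
have z1 : z * (1 - x) = 1 by apply/eqP; rewrite mulrBr mulr1 subr_eq /= zE.
exists y => //; suff <- : z = y by [].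
by rewrite -[LHS]mulr1 -y1 mulrA z1 mul1r.
Qed.

Lemma unitBZ k x : k != 0 -> unitB x -> unitB (k *: x).
Proof.
move=> k0 [y xy yx]; exists (k^-1 *: y).
  by rewrite -scaleAl -scaleAr scalerA mulfV// scale1r.
by rewrite -scaleAl -scaleAr scalerA mulVf// scale1r.
Qed.
Lemma unitBN x : unitB x -> unitB (- x).
Proof. by move=> [y xy yx]; exists (- y); rewrite mulrNN. Qed.

Lemma neumann k x : rnorm x < cabs k -> unitB (k *: (1 : B) - x).
Proof.
move=> xk; have k0 : k != 0.
  apply: contraTneq xk => ->; by rewrite -[0]/(0%:C) cabsR normr0 -leNgt rnorm_ge0.
have ck : 0 < cabs k by apply: le_lt_trans xk; exact: rnorm_ge0.
rewrite (_ : _ - _ = k *: (1 - k^-1 *: x)); last first.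
  by rewrite scalerBr scalerA mulfV// scale1r.
apply: unitBZ => //; apply: neumann1; rewrite rnormZ cabsV mulrC.
by rewrite ltr_pdivrMr// mul1r.
Qed.

Lemma spos_gt0 x t : rnorm (t%:e - x) < t -> 0 < t.
Proof. by apply: le_lt_trans; exact: rnorm_ge0. Qed.

Lemma spos_unit x : spos x -> unitB x.
Proof.
move=> [_ [t xt]]; rewrite -[x](subKr t%:e); apply: neumann.
by rewrite cabsR gtr0_norm// (spos_gt0 xt).
Qed.

Lemma halfK x : (2^-1)%:C *: (x + x) = x.
Proof.
have e : 2^-1 + 2^-1 = 1 :> R by field.
by rewrite scalerDr -scaleDC e scale1r.
Qed.

(* With [q = 1 - p / t] of norm [< 1], [p = t (1 - z)^2] for the fixed point [z] of the
   contraction [z |-> (q + z^2) / 2]. *)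
Lemma spos_sqrt p : spos p ->
  exists y, [/\ spos y, y * y = p & forall c, c * p = p * c -> c * y = y * c].
Proof.
move=> [sap [t pt]]; have t0 := spos_gt0 pt.
pose q := t^-1%:C *: (t%:e - p); pose rho := rnorm q.
have saq : sa q by apply: saZ; apply: saB.
have rho1 : rho < 1.
  by rewrite /rho rnormZr gtr0_norm ?invr_gt0// mulrC ltr_pdivrMr// mul1r.
have rho0 : 0 <= rho := rnorm_ge0 q.
have tq : t%:C *: q = t%:e - p by rewrite -scaleMC mulfV ?gt_eqF// scale1r.
pose h := (2^-1)%:C : R[i].
have h2 : forall x, h *: (x + x) = x := halfK.
(* On the ball of radius [rho] the map is a [rho]-contraction, since y^2 - z^2 = (y - z) y + z (y -
   z). The last clause is what makes the root commute with all that commutes with [p]. *)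
pose P z := [/\ sa z, rnorm z <= rho & forall c : B, c * q = q * c -> c * z = z * c].
have hn x : rnorm (h *: x) = 2^-1 * rnorm x by rewrite rnormZr gtr0_norm.
have [|||||z [saz zr zc] zE] := @fixpoint _ _ C P (fun z => h *: (q + z * z)) rho 0.
- by rewrite rho0.
- split; [exact: raddf0|by rewrite rnorm0|by move=> c _; rewrite mulr0 mul0r].
- move=> z [saz zr zc]; split.
  + by apply: saZ; apply: saD => //; apply: saM.
  + have := ler_rnormD q (z * z); have := rnormM z z; have := rnorm_ge0 z.
    rewrite hn -/rho; nra.
  + move=> c cq; rewrite -scaleAr -scaleAl mulrDl mulrDr cq.
    by rewrite mulrA (zc c)// -!mulrA (zc c).
- move=> y z [_ yr _] [_ zr _]; rewrite -scalerBr hn.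
  rewrite (_ : _ - _ = (y - z) * y + z * (y - z)); last by ncring.
  have := ler_rnormD ((y - z) * y) (z * (y - z)).
  have := rnormM (y - z) y; have := rnormM z (y - z); have := rnorm_ge0 (y - z); nra.
- move=> z hz; split.
  + apply/subr0_eq; apply: (@rnorm_eps0 _ 2) => e /hz[y [say _ _] zy].
    rewrite (_ : _ - _ = adj (z - y) - (z - y)); last by rewrite raddfB /= say; ncring.
    by have := ler_rnormB (adj (z - y)) (z - y); rewrite rnorm_adj; lra.
  + apply: (@ler_eps _ _ 1) => e /hz[y [_ yr _] zy].
    by have := ler_rnormD y (z - y); rewrite addrC subrK; lra.
  + move=> c cq; apply/subr0_eq.
    apply: (@rnorm_eps0 _ (2 * rnorm c)) => e /hz[y [_ _ yc] zy].
    rewrite (_ : _ - _ = c * (z - y) - (z - y) * c); last first.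
      by rewrite mulrBr mulrBl yc//; ncring.
    have := ler_rnormB (c * (z - y)) ((z - y) * c); have := rnormM c (z - y).
    have := rnormM (z - y) c; have := rnorm_ge0 c; nra.
have r2 : Num.sqrt t * Num.sqrt t = t by rewrite -expr2 sqr_sqrtr// ltW.
have sq : q = z + z - z * z.
  have -> : z + z = q + z * z by rewrite -{1 2}zE -scalerDr h2.
  by rewrite addrK.
exists ((Num.sqrt t)%:C *: (1 - z)); split.
- split; first by apply: saZ; apply: saB.
  exists (Num.sqrt t); rewrite -scalerBr rnormZr subKr ger0_norm ?sqrtr_ge0//.
  rewrite gtr_pMr ?sqrtr_gt0//; exact: le_lt_trans zr rho1.
- rewrite -scaleAl -scaleAr -scaleMC r2.
  rewrite (_ : _ * _ = 1 - q); last by rewrite sq; ncring.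
  by rewrite scalerBr tq subKr.
- move=> c cp; rewrite -scaleAl -scaleAr mulrBr mulrBl mulr1 mul1r zc//.
  by rewrite -scaleAl -scaleAr mulrBl mulrBr scale1Al scale1Ar cp.
Qed.

(* [y + i z] is a multiple of a unitary, and [y] is its real part. *)
Lemma sum_sqr_le s y z : 0 <= s -> sa y -> sa z -> y * z = z * y ->
  y * y + z * z = s%:e -> rnorm y ^+ 2 <= s.
Proof.
move=> s0 say saz yz yzs; pose u := y + 'i *: z.
have au : adj u = y - 'i *: z.
  rewrite /u raddfD /= adjZ say saz -scaleNr; congr (_ + _ *: _); apply/eqP.
  by rewrite eq_complex /= oppr0 !eqxx.
have uu : adj u * u = s%:e.
  rewrite au /u; set w := 'i *: z.
  have yw : y * w = w * y by rewrite /w -scaleAr -scaleAl yz.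
  have ww : w * w = - (z * z).
    rewrite /w -scaleAr -scaleAl scalerA (_ : 'i * 'i = -1) ?scaleN1r//.
    by apply/eqP; rewrite eq_complex /=; simpc.
  rewrite (_ : _ * _ = y * y + (y * w - w * y) - w * w); last by ncring.
  by rewrite yw subrr addr0 ww opprK.
have us : rnorm u ^+ 2 <= s by rewrite -rnorm_adjM uu -{2}(ger0_norm s0) rnorm_scale1.
apply: le_trans us; rewrite ler_sqr ?nnegrE ?rnorm_ge0//.
have -> : y = (2^-1)%:C *: (adj u + u).
  by rewrite -[LHS]halfK au /u addrCA subrK.
rewrite rnormZr gtr0_norm//; have := ler_rnormD (adj u) u; rewrite rnorm_adj; lra.
Qed.

Lemma spos_npos x : spos x -> npos x.
Proof. by move=> [sx [t /ltW xt]]; split => //; exists t. Qed.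
Lemma scale1D_sub t d x : (t + d)%:e - (x + d%:e) = t%:e - x.
Proof. by rewrite scaleDC; ncring. Qed.
Lemma npos_add_spos x d : npos x -> 0 < d -> spos (x + d%:e).
Proof.
move=> [sx [t xt]] d0; split; first exact: saD.
by exists (t + d); rewrite scale1D_sub; lra.
Qed.
Lemma spos_sub_npos x : spos x -> exists2 d, 0 < d & npos (x - d%:e).
Proof.
move=> [sx [t xt]]; exists (t - rnorm (t%:e - x)); first by rewrite subr_gt0.
split; first exact: saB.
exists (rnorm (t%:e - x)); rewrite {1}scaleBC opprB addrCA addrA.
rewrite (_ : _ - _ = t%:e - x)//; ncring.
Qed.
Lemma npos_sub_spos x d : npos (x - d%:e) -> 0 < d -> spos x.
Proof. by move=> h d0; rewrite -[x](subrK d%:e); apply: npos_add_spos. Qed.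
Lemma nposD x y : npos x -> npos y -> npos (x + y).
Proof.
move=> [sx [s xs]] [sy [t yt]]; split; first exact: saD.
exists (s + t); rewrite scaleDC opprD addrACA.
by apply: le_trans (ler_rnormD _ _) _; apply: lerD.
Qed.
Lemma nposZ t x : 0 <= t -> npos x -> npos (t%:C *: x).
Proof.
move=> t0 [sx [s xs]]; split; first exact: saZ.
by exists (t * s); rewrite scaleMC -scalerBr rnormZr ger0_norm// ler_wpM2l.
Qed.
Lemma npos_scale1 t : 0 <= t -> npos t%:e.
Proof. by move=> t0; split => //; exists t; rewrite subrr rnorm0. Qed.
Lemma npos_norm x t : sa x -> rnorm x <= t -> npos (t%:e - x).
Proof. by move=> sx xt; split; [exact: saB|exists t; rewrite subKr]. Qed.
Lemma npos_normD x t : sa x -> rnorm x <= t -> npos (t%:e + x).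
Proof. by move=> sx xt; rewrite -[x]opprK; apply: npos_norm; [exact: saN|rewrite rnormN]. Qed.

(** For t > |x^2| the root z of t - x^2 commutes with x and z^2 + x^2 = t, so [sum_sqr_le] gives |t
    - x^2| <= |z|^2 <= t. *)
Lemma npos_sqr x : sa x -> npos (x * x).
Proof.
move=> sx; split; first exact: saM.
pose t := rnorm (x * x) + 1; have n0 := rnorm_ge0 (x * x).
have : spos (t%:e - x * x).
  by split; [apply: saB => //; exact: saM|exists t; rewrite subKr /t ltrDl].
move=> /spos_sqrt[z [[sz _] zz zc]]; exists t; rewrite -zz.
apply: le_trans (rnormM _ _) _; rewrite -expr2; apply: (@sum_sqr_le t z x) => //.
- by rewrite /t; lra.
- by rewrite zc// mulrBr mulrBl scale1Al scale1Ar mulrA.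
- by rewrite zz subrK.
Qed.

(** The shift by [d] brings both factors within reach of [spos_sqrt]; their roots commute, and z is
    the product of the roots. *)
Lemma npos_commM x y : npos x -> npos y -> x * y = y * x -> forall d, 0 < d ->
  exists2 z, sa z & z * z = (x + d%:e) * (y + d%:e) /\
    (forall c, c * x = x * c -> c * y = y * c -> c * z = z * c).
Proof.
move=> Nx Ny xy d d0.
have [u [[su _] uu uc]] := spos_sqrt (npos_add_spos Nx d0).
have [v [[sv _] vv vc]] := spos_sqrt (npos_add_spos Ny d0).
have uc' c : c * x = x * c -> c * u = u * c.
  by move=> h; apply: uc; rewrite mulrDl mulrDr scale1Al scale1Ar h.
have vc' c : c * y = y * c -> c * v = v * c.
  by move=> h; apply: vc; rewrite mulrDl mulrDr scale1Al scale1Ar h.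
have uv : u * v = v * u by apply: vc'; symmetry; apply: uc'.
exists (u * v); first exact: saM.
split; first by rewrite -uu -vv -!mulrA; congr (_ * _); rewrite mulrA -uv mulrA.
by move=> c cx cy; rewrite mulrA uc'// -mulrA vc'// mulrA.
Qed.

(** The product (s - x + e) (s + x + e) = (s + e)^2 - x^2 has a root z commuting with x, so x^2 +
    z^2 = (s + e)^2 and [sum_sqr_le] bounds |x| by s + e. *)
Lemma npos_abs_le x s : 0 <= s -> npos (s%:e - x) -> npos (s%:e + x) -> rnorm x <= s.
Proof.
move=> s0 N1 N2; apply: (@ler_eps _ _ 1) => e e0.
have sx : sa x.
  by have [h _] := N2; rewrite -[x](addKr s%:e); apply: saD => //; apply: saN.
have xs1 : x * s%:e = s%:e * x by rewrite scale1Al scale1Ar.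
have xs : (s%:e - x) * (s%:e + x) = (s%:e + x) * (s%:e - x).
  set a := s%:e in xs1 *.
  rewrite (_ : (a - x) * _ = a * a - x * x + (a * x - x * a)); last by ncring.
  rewrite (_ : (a + x) * _ = a * a - x * x + (x * a - a * x)); last by ncring.
  by rewrite xs1 !subrr.
have [z sz [zz zc]] := npos_commM N1 N2 xs e0.
have xz : x * z = z * x.
  by apply: zc; rewrite !(mulrBl, mulrBr, mulrDl, mulrDr) xs1.
have se : 0 <= s + e by lra.
rewrite mul1r -(@ler_pXn2r _ 2) ?nnegrE ?rnorm_ge0//.
apply: (@sum_sqr_le _ x z) => //; first exact: sqr_ge0.
have -> : z * z = (s + e)%:e * (s + e)%:e - x * x.
  rewrite zz !scaleDC; set a := s%:e; set b := e%:e.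
  have xa : x * a = a * x by rewrite /a scale1Al scale1Ar.
  have xb : x * b = b * x by rewrite /b scale1Al scale1Ar.
  rewrite (_ : (a - x + b) * _ = (a + b) * (a + b) - x * x
    + ((a * x - x * a) + (b * x - x * b))); last by ncring.
  by rewrite xa xb !subrr !addr0.
by rewrite scale1Al -scaleMC addrC subrK expr2.
Qed.

Lemma npos_le x s : 0 <= s -> npos x -> npos (s%:e - x) -> rnorm x <= s.
Proof.
move=> s0 Nx Ns; apply: npos_abs_le => //; apply: nposD => //; exact: npos_scale1.
Qed.

(** The hypothesis offers a different [t] for each [d]. The choice t = |x| serves them all, because
    0 <= |x| - x <= |x| + d. *)
Lemma npos_closed x : (forall d, 0 < d -> npos (x + d%:e)) -> npos x.
Proof.
move=> h; have sx : sa x.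
  by have [s1 _] := h 1 ltr01; rewrite -[x](addrK 1%:e); apply: saB.
split=> //; exists (rnorm x); apply: (@ler_eps _ _ 1) => d d0.
have n0 := rnorm_ge0 x; rewrite mul1r.
have -> : (rnorm x)%:e - x = (rnorm x + d)%:e - (x + d%:e).
  by rewrite scale1D_sub.
apply: npos_le; first by lra.
  by rewrite scale1D_sub; apply: npos_norm.
by rewrite subKr; apply: h.
Qed.

(* [y] is a root of [x + d] and [z] a root of [K - y^-2], so that [(y z)^2 = K (x + d) - 1]. *)
Lemma npos_unit_spos x : npos x -> unitB x -> spos x.
Proof.
(* For g = (x + d)^-1 one has g = q - d g q with d |q| < 1/4, hence |g| < K. Then x + d >= 1/K, and
   d = 1/(2K) leaves x >= d. *)
move=> Nx [q xq qx]; pose K := 2 * rnorm q + 1; pose d := (2 * K)^-1.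
have n0 := rnorm_ge0 q; have K0 : 0 < K by rewrite /K; lra.
have d0 : 0 < d by rewrite invr_gt0 mulr_gt0.
have dK : d * K = 2^-1 by rewrite /d; field; rewrite gt_eqF.
have Sxd := npos_add_spos Nx d0.
have [y [Sy yy yc]] := spos_sqrt Sxd.
have [y' yy' y'y] := spos_unit Sy; have [sy _] := Sy.
have sy' : sa y'.
  by rewrite /sa -[LHS]mulr1 -yy' mulrA -{1}sy -adjM yy' adj1 mul1r.
pose g := y' * y'.
have gl : g * (x + d%:e) = 1 by rewrite -yy /g -mulrA [y' * (y * y)]mulrA y'y mul1r y'y.
have gr : (x + d%:e) * g = 1 by rewrite -yy /g -mulrA [y * (y' * y')]mulrA yy' mul1r yy'.
have gq : g = q - d%:C *: (g * q).
  apply/eqP; rewrite eq_sym subr_eq; apply/eqP.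
  by rewrite -{1}[q]mul1r -gl -mulrA mulrDl xq scale1Al mulrDr mulr1 -scaleAr.
have gn : rnorm g < K.
  have := ler_rnormB q (d%:C *: (g * q)); rewrite -gq rnormZr (gtr0_norm d0).
  have := rnormM g q; have := rnorm_ge0 g; rewrite /K in dK *; nra.
have sg : sa g by apply: saM.
have SK : spos (K%:e - g) by split; [exact: saB|exists K; rewrite subKr].
have [z [[sz _] zz zc]] := spos_sqrt SK.
have yg : y * g = g * y by rewrite /g mulrA yy' mul1r -mulrA y'y mulr1.
have yz : y * z = z * y by apply: zc; rewrite mulrBl mulrBr scale1Al scale1Ar yg.
have : npos ((y * z) * (y * z)) by apply: npos_sqr; apply: saM.
have -> : (y * z) * (y * z) = K%:C *: (x + d%:e) - 1.
  rewrite {2}yz mulrA -(mulrA y) zz mulrBr mulrBl scale1Ar -scaleAl yy.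
  by rewrite -(mulrA y g) -yg mulrA yy gr.
move=> /(@nposZ K^-1 _); rewrite invr_ge0 (ltW K0) scalerBr -scaleMC mulVf ?gt_eqF// scale1r.
move=> /(_ isT) N1; apply: (@npos_sub_spos _ d) => //.
have -> : x - d%:e = x + d%:e - K^-1%:e; last by [].
rewrite -addrA -scaleBC -scaleNC; congr (x + _%:C *: _).
by rewrite /d; field; rewrite gt_eqF.
Qed.

End Cone.

(** * Agreement with spectral positivity, and positivity of conjugates *)

Section Order.
Context {R : realType} {A : completeNormedModType (R[i])} (C : unital_cstar_alg A).
Local Notation B := (calg C).
Local Notation "t %:e" := (t%:C *: (1 : B)) (at level 2, format "t %:e").
Implicit Types (x y z c : B) (k : R[i]) (s t d e : R).
#[local] Hint Resolve sa1 sa_scale1 : core.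

(** Arens' trick: x - k = (b + i s) - i (e + s) with |b + i s|^2 <= |b|^2 + s^2. Choosing 2 e s =
    |b|^2 makes the right side equal to (e + s)^2 - e^2, so the Neumann series applies. *)
Lemma sa_sub_unit x k : sa x -> complex.Im k != 0 -> unitB (x - k *: (1 : B)).
Proof.
case: k => t e /= sx e0; pose b := x - t%:e; have sb : sa b by apply: saB.
pose s := rnorm b ^+ 2 / (2 * e); pose w := (Complex 0 s) *: (1 : B).
have aw : adj w = - w.
  rewrite adjZ adj1 -scaleNr; congr (_ *: _); apply/eqP.
  by rewrite eq_complex /= oppr0 !eqxx.
have bw : b * w = w * b by rewrite scale1Al scale1Ar.
have ww : w * w = - (s ^+ 2)%:e.
  rewrite scale1Al scalerA -scaleNr; congr (_ *: _); apply/eqP.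
  by rewrite eq_complex /= expr2; simpc.
have nbw : rnorm (b + w) ^+ 2 <= rnorm b ^+ 2 + s ^+ 2.
  rewrite -rnorm_adjM raddfD /= aw sb.
  rewrite (_ : _ * _ = b * b + (b * w - w * b) - w * w); last by ncring.
  rewrite bw subrr addr0 ww opprK -(rnorm_sa_sqr sb).
  have := ler_rnormD (b * b) (s ^+ 2)%:e; have := rnorm_scale1 C (s ^+ 2).
  rewrite ger0_norm ?sqr_ge0//; lra.
have es : 2 * e * s = rnorm b ^+ 2 by rewrite /s mulrC divfK// mulf_neq0.
rewrite (_ : _ - _ = - (Complex 0 (e + s) *: (1 : B) - (b + w))).
  apply: unitBN; apply: neumann.
  have -> : cabs (Complex 0 (e + s)) = `|e + s|.
    by rewrite /cabs normc_def /= expr0n add0r sqrtr_sqr.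
  rewrite -(@ltr_pXn2r _ 2) ?nnegrE ?rnorm_ge0// real_normK ?num_real//.
  apply: le_lt_trans nbw _; rewrite -es.
  have : 0 < e ^+ 2 by rewrite exprn_even_gt0.
  by rewrite !expr2; nra.
have -> : Complex t e = t%:C + Complex 0 e.
  by apply/eqP; rewrite eq_complex /= addr0 add0r !eqxx.
have -> : Complex 0 (e + s) = Complex 0 e + Complex 0 s.
  by apply/eqP; rewrite eq_complex /= addr0 !eqxx.
by rewrite !scalerDl /b /w; ncring.
Qed.

Lemma invertibleE x : invertible C x <-> unitB x.
Proof. by split=> [[y [xy yx]]|[y xy yx]]; exists y. Qed.

Lemma npos_le_add x s t : s <= t -> npos (s%:e + x) -> npos (t%:e + x).
Proof.
move=> st N; rewrite -(subrK s t) scaleDC -addrA; apply: nposD => //.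
by apply: npos_scale1; rewrite subr_ge0.
Qed.

Lemma npos_positive x : npos x -> positive C x.
Proof.
move=> Nx; have [sx _] := Nx; split=> // -[t e] xl.
have e0 : e = 0.
  apply/eqP/negP => /negP e0; apply: xl; apply/invertibleE.
  exact: (@sa_sub_unit x (Complex t e)).
rewrite lecE /= e0 eqxx /=; case: ltP => // t0; exfalso; apply: xl.
apply/invertibleE; rewrite e0; apply: spos_unit.
suff: spos (x + (- t)%:e) by rewrite scaleNC.
by apply: npos_add_spos => //; rewrite oppr_gt0.
Qed.

(* If the least [t0 >= 0] with [npos (t0 + x)] were positive, [t0 + x] would be invertible by the
   spectral hypothesis, and [npos_unit_spos] would allow to decrease [t0]. *)
Lemma positive_npos x : positive C x -> npos x.
Proof.
move=> [sx px]; pose S := [set t | 0 <= t /\ npos (t%:e + x)].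
have SB : lbound S 0 by move=> t [].
have Sn : S (rnorm x) by split; [exact: rnorm_ge0|exact: npos_normD].
have hS : has_inf S by split; [exists (rnorm x)|exists 0].
pose t0 := inf S; have t00 : 0 <= t0 by apply: lb_le_inf => //; exists (rnorm x).
have above t : t0 < t -> npos (t%:e + x).
  move=> t0t; have [|u [u0 Nu]] := @inf_adherent _ S (t - t0) _ hS.
    by rewrite subr_gt0.
  by rewrite -/t0 addrC subrK => ut; apply: npos_le_add Nu; exact: ltW.
have Nt0 : npos (t0%:e + x).
  apply: npos_closed => d d0; rewrite addrAC -scaleDC; apply: above; lra.
have [t0E|t0n] := eqVneq t0 0; first by move: Nt0; rewrite t0E scale0r add0r.
exfalso; have t0_gt0 : 0 < t0 by rewrite lt_def t0n.
have ux : unitB (t0%:e + x).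
  apply: contrapT => nu.
  have := px (- t0)%:C; rewrite lecR oppr_ge0 leNgt t0_gt0 => /(_ _)/notF; apply.
  rewrite /spectrum /= => /invertibleE u; apply: nu; move: u.
  by rewrite -[cone C]/(1 : B) scaleNC opprK addrC.
have [d d0 Nd] := spos_sub_npos (npos_unit_spos Nt0 ux).
pose m := Num.min d t0.
have m0 : 0 < m by rewrite lt_min d0.
have : S (t0 - m).
  split; first by rewrite subr_ge0 ge_min lexx orbT.
  apply: (@npos_le_add _ (t0 - d)); first by rewrite lerD2l lerN2 ge_min lexx.
  by rewrite scaleBC addrAC.
by move=> /(ge_inf (ex_intro _ 0 SB)); rewrite -/t0; lra.
Qed.

Lemma positiveE x : positive C x <-> npos x.
Proof. by split; [exact: positive_npos|exact: npos_positive]. Qed.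

(** Jacobson's identity: if g inverts x y - k, then (y g x - 1) / k inverts y x - k. *)
Lemma unit_swap x y k : k != 0 ->
  unitB (x * y - k *: (1 : B)) -> unitB (y * x - k *: (1 : B)).
Proof.
move=> k0 [g g1 g2]; set a := k *: (1 : B) in g1 g2 *.
have ac z : z * a = a * z by rewrite scale1Al scale1Ar.
pose h := k^-1 *: (y * g * x - 1).
have ka : k^-1 *: a = 1 by rewrite scalerA mulVf// scale1r.
exists h; rewrite /h -?scaleAr -?scaleAl -[RHS]ka; congr (_ *: _).
  rewrite (_ : _ * _ = y * ((x * y - a) * g) * x - y * x + a
    + (y * a - a * y) * g * x); last by ncring.
  by rewrite g1 ac subrr mulr1 !mul0r addr0 subrr add0r.
rewrite (_ : _ * _ = y * (g * (x * y - a)) * x - y * x + a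
  + y * g * (a * x - x * a)); last by ncring.
by rewrite g2 ac subrr mulr1 mulr0 addr0 subrr add0r.
Qed.

(** The spectra of s + x y and s + y x agree away from the point s, which is itself nonnegative. *)
Lemma npos_swap x y s : 0 <= s -> npos (s%:e + x * y) -> sa (y * x) ->
  npos (s%:e + y * x).
Proof.
move=> s0 /positiveE[_ p] sy; apply/positiveE; split=> [|k h]; first exact: saD.
have [->|k0] := eqVneq k s%:C; first by rewrite lecR.
apply: p => /invertibleE u; apply: h; apply/invertibleE.
have shift z : s%:e + z - k *: (1 : B) = z - (k - s%:C) *: (1 : B).
  by rewrite scalerBl; ncring.
have := @unit_swap x y (k - s%:C); rewrite subr_eq0 => /(_ k0).
by rewrite -!shift; apply.
Qed.

Lemma sa_adjM c : sa (adj c * c). Proof. by rewrite /sa adjM adjK. Qed.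
Lemma sa_Madj c : sa (c * adj c). Proof. by rewrite /sa adjM adjK. Qed.

(** Writing c = p + i q with p, q self-adjoint, the sum is 2 (p^2 + q^2). *)
Lemma npos_adjM_add c : npos (adj c * c + c * adj c).
Proof.
have sp : sa (c + adj c) by rewrite /sa raddfD /= adjK addrC.
have sq : sa ('i *: (c - adj c)).
  rewrite /sa adjZ raddfB /= adjK -opprB scalerN -scaleNr; congr (_ *: _).
  by apply/eqP; rewrite eq_complex /=; simpc.
have : npos ((2^-1)%:C *: ((c + adj c) * (c + adj c) + ('i *: (c - adj c)) * ('i *: (c - adj c)))).
  by apply: nposZ; [rewrite invr_ge0|apply: nposD; apply: npos_sqr].
rewrite -scaleAl -scaleAr scalerA (_ : 'i * 'i = -1); last first.
  by apply/eqP; rewrite eq_complex /=; simpc.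
rewrite scaleN1r (_ : _ - _ = (adj c * c + c * adj c) + (adj c * c + c * adj c)); last by ncring.
by rewrite halfK.
Qed.

Lemma unitB_adj c : unitB c -> unitB (adj c).
Proof. by move=> [b cb bc]; exists (adj b); rewrite -adjM ?cb ?bc adj1. Qed.
Lemma unitBM x y : unitB x -> unitB y -> unitB (x * y).
Proof.
move=> [x' xx x'x] [y' yy y'y]; exists (y' * x').
  by rewrite -mulrA (mulrA y) yy mul1r xx.
by rewrite -mulrA (mulrA x') x'x mul1r y'y.
Qed.

(** [npos_swap] turns c^* c <= 0 into c c^* <= 0; subtracting this from the positive sum c^* c + c
    c^* gives c^* c >= 0 as well, so |c|^2 = 0. *)
Lemma npos_opp0 c : npos (- (adj c * c)) -> c = 0.
Proof.
move=> N; have N2 : npos (c * - adj c).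
  rewrite -[X in npos X]add0r -(scale0C (1 : B)).
  apply: npos_swap; rewrite ?mulNr ?scale0C ?add0r//.
  by rewrite mulrN; apply: saN; exact: sa_Madj.
have N3 : npos (adj c * c).
  rewrite (_ : adj c * c = (adj c * c + c * adj c) + c * - adj c); last by ncring.
  by apply: nposD => //; exact: npos_adjM_add.
have : rnorm (adj c * c) <= 0 by apply: npos_le => //; rewrite scale0r sub0r.
rewrite rnorm_adjM => h; apply: rnorm_eq0; have := rnorm_ge0 c; nra.
Qed.

(* [c^* c <= s] gives [c c^* <= s] through the spectrum, hence
   [c^* c = (c^* c + c c^* ) - c c^* >= - s]: no positivity of [c^* c] is needed. *)
Lemma rnorm_sqr_le c s : 0 <= s -> npos (s%:e - adj c * c) -> rnorm c ^+ 2 <= s.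
Proof.
move=> s0 N; rewrite -rnorm_adjM; apply: npos_abs_le => //.
have N2 : npos (s%:e + c * - adj c).
  by apply: npos_swap; rewrite ?mulNr// mulrN; apply: saN; exact: sa_Madj.
rewrite (_ : _ + _ = (adj c * c + c * adj c) + (s%:e + c * - adj c)); last by ncring.
by apply: nposD => //; exact: npos_adjM_add.
Qed.

(* Kelley-Vaught/Fukamiya, with [x = b^* b], [h = |x|], [n = h - x]: then [c = b n] has
   [c^* c = n x n = - n h n <= 0], which forces [c = 0], i.e. [x = h].  Invertibility of [b] makes
   [x^2] strictly positive, so that only the square roots of [spos_sqrt] are needed. *)
Lemma spos_adjM b : unitB b -> spos (adj b * b : B).
Proof.
move=> ub; pose x : B := adj b * b; have ux : unitB x by apply: unitBM => //; apply: unitB_adj.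
have sx : sa x by apply: sa_adjM.
have [h [Sh hh hc]] := spos_sqrt (npos_unit_spos (npos_sqr sx) (unitBM ux ux)).
have [k [[sk _] kk kc]] := spos_sqrt Sh; have [sh _] := Sh.
have xh : x * h = h * x by apply: hc; rewrite mulrA.
pose n := h - x; have sn : sa n by apply: saB.
have nh : n * h = h * n by rewrite mulrBl mulrBr xh.
have nk : n * k = k * n by apply: kc.
have xn : x * n = - (h * n) by rewrite !mulrBr hh xh; ncring.
have cc : adj (b * n) * (b * n) = - ((k * n) * (k * n)).
  rewrite adjM sn mulrA -(mulrA n) -/x -mulrA xn mulrN -kk; congr (- _).
  by transitivity ((n * k) * (k * n)); [ncring|rewrite nk].
have : b * n = 0.
  by apply: npos_opp0; rewrite cc opprK; apply: npos_sqr; apply: saM.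
case: ub => b' _ b'b /(congr1 (fun z => b' * z)); rewrite mulr0 mulrA b'b mul1r.
by move=> /subr0_eq => hx; rewrite -/x -hx.
Qed.

(** With y + e = h^2 and h invertible, c^* (y + e) c = (h c)^* (h c) is positive by [spos_adjM]. The
    constant [e] is small enough that e c^* c <= d. *)
Lemma npos_conj c y : unitB c -> npos y -> npos (adj c * y * c).
Proof.
move=> uc Ny; apply: npos_closed => d d0.
have n0 := rnorm_ge0 (adj c * c); have n1 : 0 < rnorm (adj c * c) + 1 by lra.
pose e := d / (rnorm (adj c * c) + 1); have e0 : 0 < e by rewrite divr_gt0.
have [h [Sh hh _]] := spos_sqrt (npos_add_spos Ny e0); have [sh _] := Sh.
have := spos_npos (spos_adjM (unitBM (spos_unit Sh) uc)).
rewrite adjM sh mulrA -(mulrA _ h h) hh mulrDr mulrDl scale1Ar -scaleAl => N.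
rewrite (_ : _ + _ = adj c * y * c + e%:C *: (adj c * c)
  + (d%:e - e%:C *: (adj c * c))); last by ncring.
apply: nposD => //; apply: npos_norm; first by apply: saZ; apply: sa_adjM.
rewrite rnormZr gtr0_norm// /e mulrAC ler_pdivrMr// ler_pM2l//; lra.
Qed.

End Order.

(** * Unimodular combinations and first bounds for positive maps *)

Section PositiveMaps.
Context {R : realType} {A : completeNormedModType (R[i])} (C : unital_cstar_alg A).
Local Notation B := (calg C).
Local Notation "t %:e" := (t%:C *: (1 : B)) (at level 2, format "t %:e").
Implicit Types (x y z c : B) (k : R[i]) (s t d e : R).
#[local] Hint Resolve sa1 sa_scale1 : core.

Lemma npos0 : npos (0 : B).
Proof. by rewrite -(scale0C (1 : B)); apply: npos_scale1. Qed.

Lemma npos_sum (I : finType) (y : I -> B) : (forall i, npos (y i)) -> npos (\sum_i y i).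
Proof. by move=> h; elim/big_ind: _ => //; [exact: npos0|exact: nposD]. Qed.

(** The scalars sit next to [y] so that, for k = conj (mu i) and z the sum of the mu i y i, the
    cross terms add up to twice z^* z. *)
Lemma conj_expand t k y z :
  adj (t%:e - k *: z) * y * (t%:e - k *: z) =
  (t ^+ 2)%:C *: y - t%:C *: ((k *: y) * z + adj z * (conjc k *: y))
  + (conjc k * k) *: (adj z * y * z).
Proof.
rewrite raddfB /= sa_scale1 adjZ.
have -> : (k *: y) * z = y * (k *: z) by rewrite -scaleAl scaleAr.
have -> : adj z * (conjc k *: y) = (conjc k *: adj z) * y by rewrite -scaleAl scaleAr.
have -> : (conjc k * k) *: (adj z * y * z) = (conjc k *: adj z) * y * (k *: z).
  by rewrite -scaleAr -!scaleAl scalerA mulrC.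
set v := _ *: adj z; set w := k *: z.
rewrite expr2 scaleMC scalerDr; set a := t%:e.
have ac u : u * a = a * u by rewrite /a scale1Al scale1Ar.
have aE u : t%:C *: u = a * u by rewrite /a scale1Al.
rewrite !aE; clearbody a.
rewrite (_ : _ * _ = a * y * a - (a * (y * w) + v * y * a) + v * y * w); last by ncring.
by rewrite !ac !mulrA.
Qed.

(* Sum the conjugates of the [y i] by [t - conj (mu i) z], and those of [s - sum y] by [t - z] and
   [t + z]: for [t > |z|] these are invertible, and [s t^2 >= (2 t - s) z^* z] follows.  The choice
   [t = 2 |z| - s] contradicts [|z| > s]. *)
Lemma rnorm_sum_unimodular (I : finType) (y : I -> B) (mu : I -> R[i]) s :
  0 <= s -> (forall i, npos (y i)) -> (forall i, conjc (mu i) * mu i = 1) ->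
  npos (s%:e - \sum_i y i) -> rnorm (\sum_i mu i *: y i) <= s.
Proof.
move=> s0 Ny mu1 Ns; set z := \sum_i mu i *: y i.
have az : adj z = \sum_i conjc (mu i) *: y i.
  by rewrite /z raddf_sum; apply: eq_bigr => i _ /=; rewrite adjZ; have [-> _] := Ny i.
have cmu i : cabs (conjc (mu i)) = 1.
  apply/eqP; rewrite -(@eqrXn2 _ 2 _ 1) ?cabs_ge0 ?ler01// expr1n -(inj_eq (@complexI _)).
  by rewrite rmorphXn /= -cabsE sqr_normc conjcK mu1.
case: (leP (rnorm z) s) => // zs; exfalso.
pose t := 2 * rnorm z - s; have zt : rnorm z < t by rewrite /t; lra.
set Y := \sum_i y i in Ns.
have t_unit k : cabs k = 1 -> unitB (t%:e - k *: z).
  by move=> k1; apply: neumann; rewrite rnormZ k1 mul1r cabsR gtr0_norm//; lra.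
have N1 : npos ((t ^+ 2)%:C *: Y - (2 * t)%:C *: (adj z * z) + adj z * Y * z).
  rewrite (_ : _ + _ = \sum_i adj (t%:e - conjc (mu i) *: z) * y i * (t%:e - conjc (mu i) *: z)).
    by apply: npos_sum => i; apply: npos_conj => //; apply: t_unit.
  under eq_bigr => i _ do rewrite conj_expand conjcK (mulrC (mu i)) mu1 scale1r.
  rewrite !big_split /= sumrN -!scaler_sumr -mulr_suml -mulr_sumr big_split /=.
  rewrite -mulr_suml -mulr_sumr -az -/z; congr (_ - _ + _).
  by rewrite mulrDl mul1r scaleDC scalerDr.
have N2 : npos ((t ^+ 2)%:C *: (s%:e - Y) + adj z * (s%:e - Y) * z).
  have := nposD (npos_conj (t_unit 1 _) Ns) (npos_conj (t_unit (- 1) _) Ns).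
  have c1 : cabs (1 : R[i]) = 1 by rewrite /cabs normr1.
  have cN1 : cabs (- 1 : R[i]) = 1 by rewrite /cabs normrN1.
  move=> /(_ c1 cN1); rewrite !conj_expand => N2; rewrite -[X in npos X]halfK.
  apply: nposZ; first by rewrite invr_ge0.
  have cj : conjc (- 1 : R[i]) = - 1 by apply/eqP; rewrite eq_complex /= !oppr0 !eqxx.
  move: N2; rewrite cj conjc1 mulrNN mulr1 !scaleN1r !scale1r mulNr mulrN -opprD scalerN.
  set a := _ *: (s%:e - Y); set b := _ *: (_ + _); set c := adj z * _ * z.
  by suff -> : a + c + (a + c) = (a - b + c) + (a - - b + c); last by ncring.
have K0 : 0 < 2 * t - s by lra.
have N3 : npos ((s * t ^+ 2)%:e - (2 * t - s)%:C *: (adj z * z)).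
  rewrite (_ : _ - _ = ((t ^+ 2)%:C *: Y - (2 * t)%:C *: (adj z * z) + adj z * Y * z) +
    ((t ^+ 2)%:C *: (s%:e - Y) + adj z * (s%:e - Y) * z)); first exact: nposD.
  rewrite scalerBr -scaleMC [adj z * (_ - _)]mulrBr mulrBl scale1Ar -scaleAl scaleBC (mulrC s).
  ncring.
have : rnorm z ^+ 2 <= s * t ^+ 2 / (2 * t - s).
  apply: rnorm_sqr_le; first by rewrite divr_ge0 ?(ltW K0)// mulr_ge0 ?sqr_ge0.
  have -> : adj z * z = ((2 * t - s)^-1)%:C *: ((2 * t - s)%:C *: (adj z * z)).
    by rewrite -scaleMC mulVf ?gt_eqF// scale1r.
  by rewrite mulrC scaleMC -scalerBr; apply: nposZ => //; rewrite invr_ge0 ltW.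
rewrite ler_pdivlMr// /t; set m := rnorm z in zs *.
(* The product is m^2 (2 t - s) - s t^2 at t = 2 m - s; its quadratic factor has negative
   discriminant. *)
have : 0 < (m - s) * (4 * m ^+ 2 - 3 * s * m + s ^+ 2).
  by apply: mulr_gt0; rewrite ?subr_gt0// !expr2; nra.
by rewrite !expr2; lra.
Qed.

Definition posmap (f : B -> B) := linear_map f /\ forall x, npos x -> npos (f x).

Section PMap.
Variables (f : B -> B) (hf : posmap f).

Lemma posmapD x y : f (x + y) = f x + f y.
Proof. by rewrite -[x]scale1r hf.1 !scale1r. Qed.
Lemma posmap0 : f 0 = 0.
Proof. by apply: (addrI (f 0)); rewrite -posmapD !addr0. Qed.
Lemma posmapZ k x : f (k *: x) = k *: f x.
Proof. by rewrite -[k *: x]addr0 hf.1 posmap0 addr0. Qed.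
Lemma posmapB x y : f (x - y) = f x - f y.
Proof. by rewrite -scaleN1r addrC hf.1 scaleN1r addrC. Qed.
Lemma posmap_sum (I : finType) (y : I -> B) : f (\sum_i y i) = \sum_i f (y i).
Proof. exact: (big_morph _ posmapD posmap0). Qed.

Variables (s : R) (s0 : 0 <= s) (fs : npos (s%:e - f 1)).

Lemma posmap_bound_sa x : sa x -> rnorm (f x) <= s * rnorm x.
Proof.
move=> sx; have n0 := rnorm_ge0 x; apply: npos_abs_le; first exact: mulr_ge0.
  rewrite (_ : _ - _ = (rnorm x)%:C *: (s%:e - f 1) + f ((rnorm x)%:e - x)).
    by apply: nposD; [exact: nposZ|apply: hf.2; exact: npos_norm].
  by rewrite posmapB posmapZ scalerBr -scaleMC mulrC; ncring.
rewrite (_ : _ + _ = (rnorm x)%:C *: (s%:e - f 1) + f ((rnorm x)%:e + x)).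
  by apply: nposD; [exact: nposZ|apply: hf.2; exact: npos_normD].
by rewrite posmapD posmapZ scalerBr -scaleMC mulrC; ncring.
Qed.

(** The factor 2 comes from splitting x into two self-adjoint parts. This crude bound serves to
    control the error terms of the sharp one. *)
Lemma posmap_bound x : rnorm (f x) <= 2 * s * rnorm x.
Proof.
have sp : sa (x + adj x) by rewrite /sa raddfD /= adjK addrC.
have sq : sa ('i *: (x - adj x)).
  rewrite /sa adjZ raddfB /= adjK -opprB scalerN -scaleNr; congr (_ *: _).
  by apply/eqP; rewrite eq_complex /=; simpc.
have xE : x = (2^-1)%:C *: ((x + adj x) - 'i *: ('i *: (x - adj x))).
  rewrite scalerA (_ : 'i * 'i = -1); last by apply/eqP; rewrite eq_complex /=; simpc.
  by rewrite scaleN1r opprK -{1}[x]halfK; congr (_ *: _); ncring.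
have ci : cabs ('i : R[i]) = 1.
  by rewrite /cabs normc_def /= expr0n add0r expr1n sqrtr1.
rewrite {1}xE posmapZ posmapB posmapZ rnormZr gtr0_norm//.
have := ler_rnormB (f (x + adj x)) ('i *: f ('i *: (x - adj x))).
have := posmap_bound_sa sp; have := posmap_bound_sa sq.
rewrite !rnormZ ci !mul1r.
have := ler_wpM2l s0 (ler_rnormD x (adj x)); have := ler_wpM2l s0 (ler_rnormB x (adj x)).
rewrite rnorm_adj; lra.
Qed.

End PMap.
End PositiveMaps.

(** * Roots of unity in [R[i]] *)

Section RootsOfUnity.
Context {R : realType}.

Lemma complex_prim_root n : (0 < n)%N -> exists w : R[i], n.-primitive_root w.
Proof.
move=> n0; pose p : {poly R[i]} := 'X^n - 1.
have [r Dp] := closed_field_poly_normal p.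
rewrite (monicP _) ?monicXnsubC// scale1r in Dp.
have rn1 : all n.-unity_root r by apply/allP=> z; rewrite -root_prod_XsubC -Dp.
have sz_r : (n < (size r).+1)%N by rewrite -(size_prod_XsubC r id) -Dp size_XnsubC.
have [|z _ hz] := hasP (has_prim_root n0 rn1 _ sz_r); last by exists z.
by rewrite -separable_prod_XsubC -Dp separable_Xn_sub_1// pnatr_eq0 -lt0n.
Qed.

Lemma cabs_prim_root n (w : R[i]) : n.-primitive_root w -> cabs w = 1.
Proof.
move=> hw; have n0 := prim_order_gt0 hw.
apply/eqP; rewrite -(@pexpr_eq1 _ _ n) ?cabs_ge0//; apply/eqP/complexI.
by rewrite rmorphXn /= -cabsE -normrX (prim_expr_order hw) normr1.
Qed.

Lemma conj_mul_unimodular (w : R[i]) : cabs w = 1 -> conjc w * w = 1.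
Proof. by move=> w1; rewrite mulrC -sqr_normc cabsE w1 expr1n. Qed.

Lemma cabsX (w : R[i]) n : cabs (w ^+ n) = cabs w ^+ n.
Proof. by apply: complexI; rewrite rmorphXn /= -!cabsE normrX. Qed.

Lemma prim_root_sum n (w : R[i]) m : n.-primitive_root w ->
  \sum_(k < n) (w ^+ m) ^+ k = if (n %| m)%N then n%:R else 0.
Proof.
move=> hw; rewrite (prim_order_dvd hw); case: ifPn => [/eqP ->|wm].
  by under eq_bigr do rewrite expr1n; rewrite sumr_const card_ord.
apply/eqP; have := subrX1 (w ^+ m) n.
rewrite -exprM mulnC exprM (prim_expr_order hw) expr1n subrr => /esym/eqP.
by rewrite mulf_eq0 subr_eq0 (negPf wm).
Qed.
End RootsOfUnity.

(** * Averages of Poisson kernels over roots of unity *)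

Section RussoDye.
Context {R : realType} {A : completeNormedModType (R[i])} (C : unital_cstar_alg A).
Local Notation B := (calg C).
Local Notation "t %:e" := (t%:C *: (1 : B)) (at level 2, format "t %:e").
Implicit Types (x y z c : B) (k : R[i]) (s t d : R).
#[local] Hint Resolve sa1 sa_scale1 : core.

Lemma scaleX k x n : (k *: x) ^+ n = k ^+ n *: x ^+ n.
Proof.
elim: n => [|n IH]; first by rewrite !expr0 scale1r.
by rewrite !exprS IH -scaleAl -scaleAr scalerA.
Qed.

Lemma npos_poisson (u g : B) : rnorm u <= 1 -> (1 - u) * g = 1 -> g * (1 - u) = 1 ->
  npos (g + adj g - 1).
Proof.
move=> u1 ug gu.
have agu : adj g * (1 - adj u) = 1 by rewrite -{1}adj1 -raddfB /= -adjM ug adj1.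
have -> : g + adj g - 1 = adj g * (1%:e - adj u * u) * g.
  rewrite scale1C.
  transitivity (adj g * (1 - adj u) * g + adj g * ((1 - u) * g)
    - (adj g * (1 - adj u)) * ((1 - u) * g)).
    by rewrite agu ug !mul1r mulr1.
  ncring.
apply: npos_conj; first by exists (1 - u).
by apply: npos_norm; [exact: sa_adjM|rewrite rnorm_adjM expr_le1// rnorm_ge0].
Qed.

Section Average.
Variables (x e : B) (n : nat) (w : R[i]).
Hypotheses (x1 : rnorm x < 1) (hw : n.-primitive_root w) (xe : (1 - x ^+ n) * e = 1).

(** A closed form of (1 - w^i x)^-1: since (w^i x)^n = x^n, the first n terms of the Neumann series
    times (1 - x^n)^-1 give it exactly, without infinite sums. *)
Let g (i : 'I_n) : B := \sum_(j < n) (w ^+ i *: x) ^+ j * e.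

Lemma rnorm_rot i : rnorm (w ^+ i *: x) = rnorm x.
Proof. by rewrite rnormZ cabsX (cabs_prim_root hw) expr1n mul1r. Qed.

Lemma resolvent_inverse (i : 'I_n) : (1 - w ^+ i *: x) * g i = 1 /\ g i * (1 - w ^+ i *: x) = 1.
Proof.
have gl : (1 - w ^+ i *: x) * g i = 1.
  rewrite /g -mulr_suml mulrA -[1 - _]opprB mulNr -subrX1 opprB scaleX.
  by rewrite -exprM mulnC exprM (prim_expr_order hw) expr1n scale1r.
(* The formula yields a right inverse; it equals the two-sided Neumann inverse. *)
have [h h1 h2] : unitB (1 - w ^+ i *: x).
  by apply: neumann1; rewrite rnorm_rot.
by split=> //; suff <- : h = g i by []; rewrite -[h]mulr1 -gl mulrA h2 mul1r.
Qed.

(** A discrete Fourier coefficient: by orthogonality only the power j with n | m + j survives, and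
    [j0] is the only such j below n. *)
Lemma resolvent_average m j0 : (j0 < n)%N -> (n %| m + j0)%N ->
  \sum_(i < n) (w ^+ m) ^+ i *: g i = n%:R *: (x ^+ j0 * e).
Proof.
move=> jn nm; under eq_bigr => i _ do rewrite scaler_sumr.
rewrite exchange_big /=.
have E j : \sum_(i < n) (w ^+ m) ^+ i *: ((w ^+ i *: x) ^+ j * e) =
    (if (n %| m + j)%N then n%:R else 0) *: (x ^+ j * e).
  rewrite -(prim_root_sum (m + j) hw) scaler_suml; apply: eq_bigr => i _.
  rewrite scaleX -scaleAl scalerA; congr (_ *: _).
  by rewrite -!exprM -exprD mulnDl (mulnC i).
under eq_bigr => j _ do rewrite E.
rewrite (bigD1 (Ordinal jn))//= nm big1 ?addr0// => j jj.
rewrite ifN ?scale0r//; apply: contra jj => nmj; apply/eqP/val_inj => /=.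
have : (m + j == m + j0 %[mod n])%N by rewrite (eqP nmj) (eqP nm).
by rewrite eqn_modDl !modn_small// => /eqP.
Qed.

Definition poisson (i : 'I_n) : B := g i + adj (g i) - 1.

Lemma poisson_npos i : npos (poisson i).
Proof.
have [g1 g2] := resolvent_inverse i; apply: (@npos_poisson (w ^+ i *: x)) => //.
by rewrite rnorm_rot ltW.
Qed.

Lemma poisson_sum : \sum_(i < n) poisson i = n%:R *: (e + adj e - 1).
Proof.
have n0 := prim_order_gt0 hw; have := @resolvent_average 0 0 n0 (dvdn0 n).
under eq_bigr => i _ do rewrite expr0 expr1n scale1r.
rewrite expr0 mul1r => G.
rewrite /poisson sumrB big_split /= -raddf_sum G sumr_const card_ord /=.
by rewrite adjZ scalerBr scalerDr conjc_nat !scaler_nat.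
Qed.

(** The weights are conj (w^i), as w^(n-1) = conj w. They select x^1 in [g], x^(n-1) in its adjoint
    part, and annihilate the constant -1 because n > 1. *)
Lemma poisson_moment : (1 < n)%N ->
  \sum_(i < n) (w ^+ n.-1) ^+ i *: poisson i = n%:R *: (x * e + adj (x ^+ n.-1 * e)).
Proof.
move=> n1; have n0 : (0 < n)%N by exact: ltnW.
have wc : conjc w = w ^+ n.-1.
  have w1 := cabs_prim_root hw; have w0 : w != 0.
    by apply: contra_eq_neq w1 => ->; rewrite /cabs normr0 eq_sym oner_eq0.
  by apply: (mulIf w0); rewrite -exprSr prednK// (prim_expr_order hw) conj_mul_unimodular.
have G1 := @resolvent_average n.-1 1 n1; rewrite addn1 prednK// dvdnn expr1 in G1.
have G2 := @resolvent_average 1 n.-1; rewrite ltn_predL n0 add1n prednK// dvdnn in G2.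
rewrite /poisson; under eq_bigr => i _ do rewrite scalerBr scalerDr.
rewrite sumrB big_split /= G1// -scaler_suml prim_root_sum//.
rewrite gtnNdvd ?ltn_predL// ?scale0r ?subr0; last by rewrite -subn1 subn_gt0.
rewrite scalerDr; congr (_ + _).
transitivity (adj (n%:R *: (x ^+ n.-1 * e))); last by rewrite adjZ conjc_nat.
rewrite -G2// raddf_sum; apply: eq_bigr => i _ /=; rewrite adjZ; congr (_ *: _).
by rewrite -wc expr1 rmorphXn.
Qed.

End Average.
End RussoDye.

(** * The sharp norm bound for positive maps *)

Section NormBound.
Context {R : realType} {A : completeNormedModType (R[i])} (C : unital_cstar_alg A).
Local Notation B := (calg C).
Local Notation "t %:e" := (t%:C *: (1 : B)) (at level 2, format "t %:e").
Implicit Types (x y z c : B) (k : R[i]) (t d : R).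
#[local] Hint Resolve sa1 sa_scale1 : core.

Variables (f : B -> B) (hf : posmap f) (s : R) (s0 : 0 <= s) (fs : npos (s%:e - f 1)).

Lemma posmap_sa x : sa x -> sa (f x).
Proof.
move=> sx; have [h _] := hf.2 _ (npos_norm sx (lexx _)).
have [h1 _] := hf.2 _ (npos_scale1 C (rnorm_ge0 x)).
by rewrite -(subKr (rnorm x)%:e x) (posmapB hf); apply: saB.
Qed.

(* [x] is, up to an error of order [|x|^(n+1)], the average of [conj (w^i) P_i] where the Poisson
   kernels [P_i] at the [n+2]-nd roots of unity are positive with average close to [1]. *)
Lemma posmap_norm_approx x n : rnorm x < 1 ->
  rnorm (f x) <= s + 6 * s * (1 - rnorm x)^-1 * rnorm x ^+ n.+1.
Proof.
move=> x1; set q := rnorm x in x1 *; have q0 : 0 <= q := rnorm_ge0 x.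
(* Two more than [n], so that [poisson_moment] applies and [N.-1] computes to [n.+1]. *)
set N := n.+2; have [w hw] := @complex_prim_root R N isT.
have xN : rnorm (x ^+ N) <= q ^+ n.+2 by apply: rnormX.
have qn0 : 0 <= q ^+ n.+1 by apply: exprn_ge0.
have qn1 : q ^+ n.+1 <= q by rewrite exprS ler_piMr// exprn_ile1// ltW.
have qN : q ^+ n.+2 = q * q ^+ n.+1 by rewrite exprS.
have [|e xe _] := @neumann1 _ _ C (x ^+ N).
  by apply: le_lt_trans xN _; rewrite qN; nra.
pose L := (1 - q)^-1; have L0 : 0 < L by rewrite invr_gt0 subr_gt0.
have LE : L = 1 + q * L by rewrite /L; field; rewrite subr_eq0 gt_eqF.
have eE : e = 1 + x ^+ N * e by rewrite -{1}xe mulrBl mul1r subrK.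
have eL : rnorm e <= L.
  have := ler_rnormD (1 : B) (x ^+ N * e); rewrite -eE => h.
  have h1 : rnorm (x ^+ N * e) <= q * rnorm e.
    apply: le_trans (rnormM _ _) _; apply: ler_wpM2r; first exact: rnorm_ge0.
    by apply: le_trans xN _; rewrite qN ler_piMr//; lra.
  have : rnorm e * (1 - q) <= 1 by have := rnorm1 C; lra.
  by rewrite -ler_pdivlMr ?subr_gt0// div1r.
pose eta := rnorm (e - 1).
have etaL : eta <= q * (q ^+ n.+1 * L).
  rewrite /eta {1}eE addrC addKr mulrA -qN.
  by apply: le_trans (rnormM _ _) _; apply: ler_pM => //; exact: rnorm_ge0.
have eta0 : 0 <= eta := rnorm_ge0 _.
pose V : R := N%:R; have V0 : 0 < V by rewrite ltr0n.
have VE z : V^-1%:C *: (N%:R *: z) = z.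
  by rewrite -(rmorph_nat (real_complex R)) -scaleMC mulVf ?gt_eqF// scale1C.
pose y (i : 'I_N) := f (V^-1%:C *: poisson x e w i).
pose mu (i : 'I_N) := (w ^+ N.-1) ^+ i.
have w1 := cabs_prim_root hw.
have Ny i : npos (y i).
  apply: hf.2; apply: nposZ; first by rewrite invr_ge0 ltW.
  exact: poisson_npos.
have mu1 i : conjc (mu i) * mu i = 1.
  by apply: conj_mul_unimodular; rewrite /mu !cabsX w1 !expr1n.
have YE : \sum_i y i = f (e + adj e - 1).
  by rewrite -(posmap_sum hf) -scaler_sumr (poisson_sum x e hw) VE.
have ZE : \sum_i mu i *: y i = f (x * e + adj (x ^+ n.+1 * e)).
  rewrite -[X in f X]VE -(poisson_moment x e hw)// scaler_sumr (posmap_sum hf).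
  by apply: eq_bigr => i _; rewrite /y -(posmapZ hf) !scalerA mulrC.
have sv : sa ((e - 1) + adj (e - 1)) by rewrite /sa raddfD /= adjK addrC.
have Zle : rnorm (\sum_i mu i *: y i) <= s + s * (2 * eta).
  apply: rnorm_sum_unimodular => //; first by rewrite addr_ge0// !mulr_ge0.
  rewrite YE (_ : e + adj e - 1 = 1 + ((e - 1) + adj (e - 1))); last first.
    by rewrite raddfB /= adj1; ncring.
  rewrite (posmapD hf) scaleDC opprD addrACA; apply: nposD => //.
  apply: npos_norm; first exact: posmap_sa.
  apply: le_trans (posmap_bound_sa hf s0 fs sv) _; apply: ler_wpM2l => //.
  by have := ler_rnormD (e - 1) (adj (e - 1)); rewrite rnorm_adj -/eta; lra.
have -> : f x = \sum_i mu i *: y i - f (x * (e - 1) + adj (x ^+ n.+1 * e)).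
  rewrite ZE -(posmapB hf); congr f; ncring.
apply: le_trans (ler_rnormB _ _) _.
have h1 := posmap_bound hf s0 fs (x * (e - 1) + adj (x ^+ n.+1 * e)).
have h2 : rnorm (x * (e - 1) + adj (x ^+ n.+1 * e)) <= q * eta + q ^+ n.+1 * L.
  apply: le_trans (ler_rnormD _ _) _; rewrite rnorm_adj; apply: lerD; first exact: rnormM.
  apply: le_trans (rnormM _ _) _; apply: ler_pM; rewrite ?rnorm_ge0//; exact: rnormX.
set G := q ^+ n.+1 * L in etaL h2 *; have G0 : 0 <= G by apply: mulr_ge0 => //; exact: ltW.
(* The 6 is 2 + 4: the sum of the [y i] exceeds s by at most 2 s eta <= 2 s G, and the remainder, of
   norm at most 2 G, costs the factor 2 s of [posmap_bound]. *)
have -> : 6 * s * (1 - q)^-1 * q ^+ n.+1 = s * (6 * G) by rewrite /G -/L; ring.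
have h3 : rnorm (x * (e - 1) + adj (x ^+ n.+1 * e)) <= 2 * G by nra.
have h4 : eta <= G by nra.
by have := ler_wpM2l s0 h3; have := ler_wpM2l s0 h4; lra.
Qed.

Theorem posmap_norm x : rnorm (f x) <= s * rnorm x.
Proof.
have small z : rnorm z < 1 -> rnorm (f z) <= s.
  move=> z1; apply: (@ler_eps _ _ _ (6 * s * (1 - rnorm z)^-1)) => d d0.
  have [|m hm] := @expr_small _ (rnorm z) d _ d0; first by rewrite rnorm_ge0.
  apply: le_trans (posmap_norm_approx m z1) _; rewrite lerD2l ler_wpM2l//.
    by rewrite !mulr_ge0// invr_ge0 subr_ge0 ltW.
  by rewrite exprS ltW// (le_lt_trans _ hm)// ler_piMl ?exprn_ge0 ?rnorm_ge0// ltW.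
apply: (@ler_eps _ _ _ s) => d d0; have n0 := rnorm_ge0 x.
have r0 : 0 < rnorm x + d by lra.
have xE : x = (rnorm x + d)%:C *: ((rnorm x + d)^-1%:C *: x).
  by rewrite -scaleMC mulfV ?lt0r_neq0// scale1C.
rewrite -mulrDr {1}xE (posmapZ hf) rnormZr gtr0_norm// mulrC ler_pM2r//; apply: small.
by rewrite rnormZr gtr0_norm ?invr_gt0// mulrC ltr_pdivrMr// mul1r ltrDl.
Qed.
End NormBound.

(** * Operator norm *)

Section OpNorm.
Context {R : realType} {A : completeNormedModType (R[i])}.
Implicit Types (f : A -> A) (x y : A) (k : R[i]).

Lemma opnorm_le f (s : R) : 0 <= s -> (forall x, rnorm (f x) <= s * rnorm x) -> opnorm f <= s.
Proof.
move=> s0 h; apply: ge_sup; first by exists (rnorm (f 0)), 0; rewrite //= rnorm0 ler01.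
by move=> _ [x /= x1 <-]; apply: le_trans (h x) _; rewrite -[leRHS]mulr1 ler_wpM2l.
Qed.

(** [sup] of an unbounded set is 0, so some bound [M] must be known before [opnorm] dominates the
    values. *)
Lemma le_opnorm f (M : R) x : 0 <= M -> (forall x, rnorm (f x) <= M * rnorm x) ->
  rnorm x <= 1 -> rnorm (f x) <= opnorm f.
Proof.
move=> M0 h x1; apply: ub_le_sup; last by exists x.
by exists M => _ [y /= y1 <-]; apply: le_trans (h y) _; rewrite -[leRHS]mulr1 ler_wpM2l.
Qed.
End OpNorm.

(** * Resolvents of bounded maps *)

Section Spectral.
Context {R : realType} {A : completeNormedModType (R[i])} (C : unital_cstar_alg A).
Local Notation B := (calg C).
Implicit Types (f : B -> B) (x y : B) (k : R[i]).

(** Solving f y - k y = x means finding a fixed point of y |-> (f y - x) / k, a contraction of ratio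
    s / |k|. Linearity of the solution map follows from injectivity, its bound from |k| |g x| <= s
    |g x| + |x|. *)
Lemma resolvent_exists f k (s : R) : linear_map f -> (forall x, rnorm (f x) <= s * rnorm x) ->
  0 <= s < cabs k -> exists g : B -> B, [/\ linear_map g, bounded_map g,
    forall x, g (f x - k *: x) = x & forall x, f (g x) - k *: g x = x].
Proof.
move=> lf fs /andP[s0 sk]; have k_gt0 : 0 < cabs k by apply: le_lt_trans sk.
have k0 : k != 0 by apply: contraTneq k_gt0 => ->; rewrite /cabs normr0 ltxx.
have fB x y : f (x - y) = f x - f y by rewrite -scaleN1r addrC lf scaleN1r addrC.
have inj x y : f x - k *: x = f y - k *: y -> x = y.
  move=> h; apply/subr0_eq/rnorm_eq0.
  have : f (x - y) = k *: (x - y).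
    rewrite fB scalerBr; apply/eqP; rewrite -subr_eq0; apply/eqP.
    transitivity ((f x - k *: x) - (f y - k *: y)); first by ncring.
    by rewrite h subrr.
  move=> /(congr1 rnorm); rewrite rnormZ => e; have := fs (x - y); rewrite e.
  have := rnorm_ge0 (x - y); nra.
have ex x : exists y, f y - k *: y = x.
  have q01 : 0 <= s / cabs k < 1 by rewrite divr_ge0 ?(ltW k_gt0)//= ltr_pdivrMr// mul1r.
  have [||||y _ yE] := @fixpoint _ _ C (fun=> True) (fun y => k^-1 *: (f y - x)) _ 0 q01 => //.
    move=> y z _ _; rewrite -scalerBr rnormZ cabsV.
    rewrite (_ : _ - _ = f (y - z)); last by rewrite fB; ncring.
    by rewrite mulrC mulrAC ler_pM2r ?invr_gt0// fs.
  by exists y; rewrite -{2}yE scalerA mulfV// scale1r subKr.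
pose g x := projT1 (cid (ex x)).
have gE x : f (g x) - k *: g x = x by rewrite /g; case: cid.
have gK x : g (f x - k *: x) = x by apply: inj; rewrite gE.
exists g; split=> //.
  move=> l x y; apply: inj; rewrite gE lf.
  transitivity (l *: (f (g x) - k *: g x) + (f (g y) - k *: g y)); first by rewrite !gE.
  by rewrite scalerBr scalerDr !scalerA (mulrC k); ncring.
exists (cabs k - s)^-1 => x; rewrite mulrC ler_pdivlMr ?subr_gt0//.
have E : k *: g x = f (g x) - x.
  by apply/eqP; rewrite eq_sym subr_eq addrC -subr_eq gE.
have := ler_rnormB (f (g x)) x; have := fs (g x); rewrite -E rnormZ; lra.
Qed.

End Spectral.

(** * Elementary similarity, spectral radius and the equivalences *)

Section Similarity.
Context {R : realType} {A : completeNormedModType (R[i])} (C : unital_cstar_alg A).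
Local Notation B := (calg C).
Local Notation "t %:e" := (t%:C *: (1 : B)) (at level 2, format "t %:e").
Implicit Types (f g : B -> B) (v b c x y : B) (k : R[i]).

Lemma positive_mapE f : positive_map C f <-> posmap f.
Proof. by split=> -[lf pf]; split=> // x /positiveE/pf/positiveE. Qed.

Lemma posmap_bounded f : posmap f -> forall x, rnorm (f x) <= rnorm (f 1) * rnorm x.
Proof.
move=> hf; apply: posmap_norm => //; first exact: rnorm_ge0.
by apply: npos_norm => //; apply: posmap_sa hf _ _; exact: sa1.
Qed.

Lemma posmap_opnorm_ge f x : posmap f -> rnorm x <= 1 -> rnorm (f x) <= opnorm f.
Proof. by move=> hf; apply: le_opnorm (rnorm_ge0 (f 1)) _; apply: posmap_bounded. Qed.

Lemma posmap_opnorm f x : posmap f -> rnorm (f x) <= opnorm f * rnorm x.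
Proof.
move=> hf; have [/rnorm_eq0 ->|x0] := eqVneq (rnorm x) 0.
  by rewrite (posmap0 hf) !rnorm0 mulr0.
have x_gt0 : 0 < rnorm x by rewrite lt_def x0 rnorm_ge0.
rewrite -ler_pdivrMr// mulrC -[X in X * _]gtr0_norm ?invr_gt0// -rnormZr -(posmapZ hf).
by apply: posmap_opnorm_ge => //; rewrite rnormZr gtr0_norm ?invr_gt0// mulVf.
Qed.

(** For [b] inverse to [v] this is alpha_v^-1 o f o alpha_v, because [adj b] inverts [adj v];
    exchanging [v] and [b] undoes it. *)
Definition conj_map v b f x : B := adj b * f (adj v * x * v) * b.

Lemma posmap_conj v b f : unitB v -> unitB b -> posmap f -> posmap (conj_map v b f).
Proof.
move=> uv ub hf; split=> [k x y|x Nx].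
  rewrite /conj_map mulrDr mulrDl -scaleAr -scaleAl hf.1 mulrDr mulrDl.
  by rewrite -scaleAr -scaleAl.
by apply: npos_conj => //; apply: hf.2; apply: npos_conj.
Qed.

Lemma conjK v b x : b * v = 1 -> adj v * (adj b * x * b) * v = x.
Proof. by move=> bv; rewrite !mulrA -adjM bv adj1 mul1r -mulrA bv mulr1. Qed.

Lemma adj_mul1 (a b : B) : a * b = 1 -> adj b * adj a = 1.
Proof. by rewrite -adjM => ->; exact: adj1. Qed.

Lemma linear_conj v b f : linear_map f -> linear_map (conj_map v b f).
Proof.
move=> lf k x y; rewrite /conj_map mulrDr mulrDl -scaleAr -scaleAl lf mulrDr mulrDl.
by rewrite -scaleAr -scaleAl.
Qed.

Lemma bounded_conj v b f : bounded_map f -> bounded_map (conj_map v b f).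
Proof.
move=> [M hM]; pose L := `|M| * (rnorm v * rnorm v).
have L0 : 0 <= L by rewrite !mulr_ge0 ?rnorm_ge0.
exists (rnorm b * L * rnorm b) => x; rewrite /conj_map.
have conj_le c z : rnorm (adj c * z * c) <= rnorm c * rnorm z * rnorm c.
  apply: le_trans (rnormM _ _) _; apply: ler_wpM2r; first exact: rnorm_ge0.
  by rewrite -(rnorm_adj c) rnormM.
apply: le_trans (conj_le _ _) _.
rewrite [leRHS]mulrAC; apply: ler_wpM2r; first exact: rnorm_ge0.
rewrite -[leRHS]mulrA; apply: ler_wpM2l; first exact: rnorm_ge0.
apply: le_trans (hM _) _; apply: le_trans (ler_wpM2r (rnorm_ge0 _) (ler_norm M)) _.
rewrite /L -[leRHS]mulrA; apply: ler_wpM2l => //.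
by apply: le_trans (conj_le _ _) _; rewrite mulrAC.
Qed.

(** By contraposition: conjugating a resolvent of the conjugated map back by [conj_map b v] gives a
    resolvent of f. *)
Lemma op_spectrum_conj v b f k : b * v = 1 ->
  op_spectrum f k -> op_spectrum (conj_map v b f) k.
Proof.
move=> bv fk [g [lg [bg [g1 g2]]]]; apply: fk; exists (conj_map b v g).
have conjB (c y z : B) : adj c * (y - k *: z) * c = adj c * y * c - k *: (adj c * z * c).
  by rewrite mulrBr mulrBl -scaleAr -scaleAl.
split; first exact: linear_conj.
split; first exact: bounded_conj.
split=> x; rewrite /conj_map.
  rewrite conjB; have <- : conj_map v b f (adj b * x * b) = adj b * f x * b.
    by rewrite /conj_map conjK.
  by rewrite g1 conjK.
set u := adj b * x * b.
have -> : f (adj v * g u * v) = adj v * conj_map v b f (g u) * v by rewrite /conj_map conjK.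
by rewrite -conjB g2 conjK.
Qed.

Lemma op_spectral_radius_conj_le f v b (s : R) : b * v = 1 ->
  0 <= s -> linear_map f -> (forall x, rnorm (conj_map v b f x) <= s * rnorm x) ->
  op_spectral_radius f <= s.
Proof.
move=> bv s0 lf fs; rewrite /op_spectral_radius; set S := (X in sup X).
(* [sup] of the empty set is 0, which is at most [s]. *)
have [S0|/set0P S0] := eqVneq S set0; first by rewrite S0 sup0.
apply: ge_sup => // _ [k fk <-]; rewrite leNgt; apply/negP => sk.
apply: (op_spectrum_conj bv fk).
have [|g [lg bg g1 g2]] := @resolvent_exists _ _ C (conj_map v b f) k s (linear_conj v b lf) fs.
  by rewrite s0.
by exists g.
Qed.

Lemma op_spectral_radius_ge0 f : 0 <= op_spectral_radius f.
Proof.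
rewrite /op_spectral_radius; set S := (X in sup X).
have [hS|/sup_out -> //] := pselect (has_sup S).
have [[t [k fk kt]] ubS] := hS; apply: (@le_trans _ _ t); last first.
  by apply: ub_le_sup => //; exists k.
by rewrite -kt; exact: cabs_ge0.
Qed.

Lemma strictly_positiveE x : strictly_positive C x <-> spos x.
Proof.
split=> [[/positiveE Nx /invertibleE ux]|Sx]; first exact: npos_unit_spos.
by split; [apply/positiveE; exact: spos_npos|apply/invertibleE; exact: spos_unit].
Qed.

Lemma left_right_inv v b c : c * v = 1 -> v * b = 1 -> c = b.
Proof. by move=> cv vb; rewrite -[c]mulr1 -vb mulrA cv mul1r. Qed.

End Similarity.

Theorem theorem3p5 (R : realType) (A : completeNormedModType (R[i]))
  (C : unital_cstar_alg A) (phi : A -> A) (hphi : positive_map C phi) :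
  let r := op_spectral_radius phi in
  let P1 := exists psi : A -> A, positive_map C psi /\
      (exists a b c : A, is_inverse C a b /\ is_inverse C (cstar C a) c /\
         (forall x, phi x = alpha_inv C c b (psi (alpha C a x)))) /\
      opnorm psi = r in
  let P2 := exists w : A, strictly_positive C w /\ cle C (phi w) (r%:C *: w) in
  let P3 := exists v b c : A, strictly_positive C v /\ is_inverse C v b /\
      is_inverse C (cstar C v) c /\
      opnorm (fun x => alpha_inv C c b (phi (alpha C v x))) = r in
  (P1 <-> P2) /\ (P1 <-> P3).
Proof.
move=> r P1 P2 P3.
have f_pos : posmap (phi : calg C -> calg C) by apply/positive_mapE.
have r0 : 0 <= r := op_spectral_radius_ge0 (C := C) phi.
have alphaE (a c b : calg C) (f : calg C -> calg C) : c = adj b ->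
  (fun x => alpha_inv C c b (f (alpha C a x))) = conj_map a b f.
  by move=> ->.
have P12 : P1 -> P2.
  move=> [psi [/positive_mapE psi_pos [[a [b [c [[ab ba] [[ac ca] phiE]]]]] psir]]].
  have cE : c = adj b :> calg C.
    by apply: (@left_right_inv _ _ C (adj a)) => //; exact: adj_mul1.
  have ub : unitB (b : calg C) by exists a.
  exists ((adj b * b : calg C) : A); split.
    by apply/strictly_positiveE; exact: spos_adjM.
  apply/positiveE.
  have a1 : adj a * (adj b * b) * a = 1 :> calg C by rewrite -[adj b]mulr1 conjK.
  have -> : phi (adj b * b : calg C) = adj b * (psi (1 : calg C) : calg C) * b :> calg C.
    by rewrite phiE cE -[LHS]/(conj_map a b (psi : calg C -> calg C) (adj b * b)) /conj_map a1.
  have -> : r%:C *: (adj b * b) - (adj b * (psi (1 : calg C) : calg C) * b) =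
      adj b * (r%:C *: (1 : calg C) - psi (1 : calg C)) * b :> calg C.
    by rewrite mulrBr mulrBl scale1Ar -scaleAl.
  apply: npos_conj => //; apply: npos_norm; first by apply: posmap_sa psi_pos _ _; exact: sa1.
  by rewrite -psir; apply: posmap_opnorm_ge => //; exact: rnorm1.
have P23 : P2 -> P3.
  move=> [w [/strictly_positiveE /spos_sqrt[v [Sv vv _]] /positiveE wr]].
  have [b vb bv] := spos_unit Sv; have [sv _] := Sv.
  have sb : sa b by apply: (@left_right_inv _ _ C v) => //; rewrite -{1}sv -adjM vb adj1.
  exists v, b, b; split; first exact/strictly_positiveE.
  split=> //; split; first by rewrite -[cstar C v]/(adj v : A) sv.
  rewrite (alphaE v b b phi)//.
  have psi_pos : posmap (conj_map v b (phi : calg C -> calg C)).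
    by apply: posmap_conj => //; [exists b|exists v].
  apply/eqP; rewrite eq_le; apply/andP; split.
    apply: opnorm_le => //; apply: posmap_norm => //.
    rewrite /conj_map mulr1 sv vv sb.
    have -> : r%:C *: (1 : calg C) - b * (phi w : calg C) * b =
        adj b * (r%:C *: (w : calg C) - phi w) * b :> calg C.
      rewrite sb mulrBr mulrBl -scaleAr -scaleAl -vv mulrA bv mul1r vb //.
    by apply: npos_conj => //; exists v.
  apply: (op_spectral_radius_conj_le (v := v) (b := b)) => //.
  - by apply: le_trans (rnorm_ge0 _) (posmap_opnorm_ge psi_pos (rnorm1 C)).
  - by case: f_pos.
  - by move=> x; apply: posmap_opnorm.
have P31 : P3 -> P1.
  move=> [v [b [c [Sv [[vb bv] [[vc cv] vr]]]]]].
  have cE : c = adj b :> calg C.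
    by apply: (@left_right_inv _ _ C (adj v)) => //; exact: adj_mul1.
  exists (conj_map v b (phi : calg C -> calg C)); split.
    by apply/positive_mapE/posmap_conj => //; [exists b|exists v].
  split; last by rewrite -vr (alphaE v c b phi).
  (* The similarity leads back from psi to phi, so the conjugating element is v^-1, with inverse
     v. *)
  exists b, v, (adj v : calg C); split=> //; split.
    by split; exact: (@adj_mul1 _ _ C).
  move=> x; rewrite -[RHS]/(conj_map b v (conj_map v b (phi : calg C -> calg C)) x).
  by rewrite /conj_map !conjK.
split; split.
- exact: P12.
- by move=> /P23/P31.
- by move=> /P12/P23.
- exact: P31.
Qed.
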